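(* Let $\ell$ be a commutative unital ring with involution containing $\lambda$ with $\lambda+\lambda^*=1$, let $G$ be a group, $E$ a graph and $\omega:E^1\to G$ a weight. Consider the graded $*$-homomorphism $q:\ell^{(\mathrm{reg}(E))}\to\mathcal{K}_\omega(E)$, $\chi_v\mapsto q_v$. Let $\mathcal{A}$ be an additive category and let $F$ be a $\mathrm{reg}(E)$-additive, $E$-stable functor from $G$-graded $*$-algebras to $\mathcal{A}$. Then $F(q)$ is an isomorphism.
   Context: Graphs and algebras. $E$ has vertices $E^0$, edges $E^1$, source/range maps $s,r$; $\mathrm{reg}(E)=\{v:0<\#s^{-1}(v)<\infty\}$. The Cohn algebra $C(E)$ is the $\ell$-algebra generated by $v\in E^0$, $e,e^*$ ($e\in E^1$) with relations $vw=\delta_{v,w}v$, $s(e)e=e=e\,r(e)$, $r(e)e^*=e^*=e^*s(e)$, $e^*f=\delta_{e,f}r(e)$; its involution is semilinear over that of $\ell$, fixes vertices and sends $e\mapsto e^*$. For $v\in\mathrm{reg}(E)$, $q_v=v-\sum_{s(e)=v}ee^*$, and $\mathcal{K}(E)\subset C(E)$ is the two-sided ideal generated by the $q_v$, $v\in\mathrm{reg}(E)$. $\mathcal{K}_\omega(E)$ is $\mathcal{K}(E)$ with the $G$-grading induced by $|v|=1$, $|e|=\omega(e)$, $|e^*|=\omega(e)^{-1}$. $\ell^{(S)}$ is the algebra of finitely supported functions on $S$, with pointwise operations and trivial grading; $\chi_v$ are characteristic functions. $\ell$-algebras are associative, not necessarily unital. A $G$-graded $*$-algebra is a $G$-graded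 $\ell$-algebra with additive involution with $(ab)^*=b^*a^*$, $(\mu a)^*=\mu^*a^*$, $A_g^*\subset A_{g^{-1}}$; morphisms are degree-preserving $*$-homomorphisms. A $G$-graded set is a set $X$ with a function $|\cdot|:X\to G$. $M_XA$ is the algebra of finitely supported $X\times X$-matrices with conjugate-transpose involution and grading $|\varepsilon_{x,y}\otimes a|=|x||a||y|^{-1}$. $F$ is $E$-stable if it inverts the upper-left corner inclusions $A\to M_\pm A$, where $M_\pm A=M_2A$ with involution $x\mapsto hx^*h$, $h=\mathrm{diag}(1,-1)$ ($\iota_+$-stability), and inverts $M_XA\to M_{X\sqcup Y}A$ for all $G$-graded sets $X,Y$ of cardinality at most $\#(E^0\sqcup E^1\sqcup\mathbb{N}\sqcup G)$ ($G$-stability). $F$ is $I$-additive if direct sums of cardinality $\le\#I$ exist in $\mathcal{A}$ and $\bigoplus_{j\in J}F(A_j)\to F(\bigoplus_{j\in J}A_j)$ is an isomorphism whenever $\#J\le\#I$. *)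

(* Defs.v *)
From HB Require Import structures.
From mathcomp Require Import all_boot all_order all_algebra.
From mathcomp Require Import all_classical.
Set Implicit Arguments.
Unset Strict Implicit.
Unset Printing Implicit Defensive.
Import GRing.Theory.
Local Open Scope classical_set_scope.
Local Open Scope ring_scope.

Record category := Category {
  ob :> Type;
  mor : ob -> ob -> Type;
  idm : forall x, mor x x;
  compm : forall x y z, mor y z -> mor x y -> mor x z;
  comp1m : forall x y (f : mor x y), compm (idm y) f = f;
  compm1 : forall x y (f : mor x y), compm f (idm x) = f;
  compmA : forall x y z t (h : mor z t) (g : mor y z) (f : mor x y),
    compm h (compm g f) = compm (compm h g) f
}.

Definition is_iso (C : category) (x y : C) (f : mor x y) : Prop :=
  exists g : mor y x, compm g f = idm x /\ compm f g = idm y.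

Record functor (C D : category) := Functor {
  fob :> C -> D;
  fmor : forall x y : C, mor x y -> mor (fob x) (fob y);
  fmor1 : forall x, fmor (idm x) = idm (fob x);
  fmorM : forall x y z (g : mor y z) (f : mor x y),
    fmor (compm g f) = compm (fmor g) (fmor f)
}.

Definition is_coproduct (C : category) (J : Type) (a : J -> C) (c : C)
    (inj : forall j, mor (a j) c) : Prop :=
  forall (x : C) (f : forall j, mor (a j) x),
    exists! h : mor c x, forall j, compm h (inj j) = f j.

Record additive_category := AdditiveCategory {
  aob : Type;
  ahom : aob -> aob -> zmodType;
  aidm : forall x, ahom x x;
  acomp : forall x y z, ahom y z -> ahom x y -> ahom x z;
  acomp1m : forall x y (f : ahom x y), acomp (aidm y) f = f;
  acompm1 : forall x y (f : ahom x y), acomp f (aidm x) = f;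
  acompmA : forall x y z t (h : ahom z t) (g : ahom y z) (f : ahom x y),
    acomp h (acomp g f) = acomp (acomp h g) f;
  acompDl : forall x y z (g1 g2 : ahom y z) (f : ahom x y),
    acomp (g1 + g2) f = acomp g1 f + acomp g2 f;
  acompDr : forall x y z (g : ahom y z) (f1 f2 : ahom x y),
    acomp g (f1 + f2) = acomp g f1 + acomp g f2;
  azero : exists z, forall x,
    (forall f : ahom z x, f = 0) /\ (forall f : ahom x z, f = 0);
  abiproduct : forall x y, exists b (i1 : ahom x b) (i2 : ahom y b)
      (p1 : ahom b x) (p2 : ahom b y),
    [/\ acomp p1 i1 = aidm x, acomp p2 i2 = aidm y,
        acomp p2 i1 = 0, acomp p1 i2 = 0
      & acomp i1 p1 + acomp i2 p2 = aidm b]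
}.

Definition category_of_additive (A : additive_category) : category :=
  @Category (aob A) (@ahom A) (@aidm A) (@acomp A)
    (@acomp1m A) (@acompm1 A) (@acompmA A).
Coercion category_of_additive : additive_category >-> category.

Definition card_atmost (S T : Type) : Prop := exists f : S -> T, injective f.

Record inv_ring := InvRing {
  ir_ring :> comPzRingType;
  rconj : {rmorphism ir_ring -> ir_ring};
  rconjK : involutive rconj
}.

(* The grading is the family of submodules [homog g]; the last two axioms say
   that the algebra is their internal direct sum. *)
Record gsalg (l : inv_ring) (G : groupType) := GSAlg {
  gs_mod :> lmodType l;
  gmul : gs_mod -> gs_mod -> gs_mod;
  gstar : gs_mod -> gs_mod;
  homog : G -> gs_mod -> Prop;
  gmulA : associative gmul;
  gmulDl : left_distributive gmul +%R;
  gmulDr : right_distributive gmul +%R;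
  gmulZl : forall (k : l) a b, gmul (k *: a) b = k *: gmul a b;
  gmulZr : forall (k : l) a b, gmul a (k *: b) = k *: gmul a b;
  gstarD : {morph gstar : a b / a + b};
  gstarM : forall a b, gstar (gmul a b) = gmul (gstar b) (gstar a);
  gstarZ : forall (k : l) a, gstar (k *: a) = rconj l k *: gstar a;
  gstarK : involutive gstar;
  homog0 : forall g, homog g 0;
  homogD : forall g a b, homog g a -> homog g b -> homog g (a + b);
  homogZ : forall g (k : l) a, homog g a -> homog g (k *: a);
  homogM : forall g h a b,
    homog g a -> homog h b -> homog (g * h)%g (gmul a b);
  homog_star : forall g a, homog g a -> homog (g^-1)%g (gstar a);
  homog_span : forall a, exists2 r : seq gs_mod,
    (forall b, b \in r -> exists g, homog g b) & a = \sum_(b <- r) b;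
  homog_indep : forall (s : seq G) (c : G -> gs_mod), uniq s ->
    (forall g, homog g (c g)) -> \sum_(g <- s) c g = 0 ->
    forall g, g \in s -> c g = 0
}.

Record gsmor (l : inv_ring) (G : groupType) (A B : gsalg l G) := GSMor {
  gsfun :> {linear A -> B};
  gsmorM : forall a b, gsfun (gmul a b) = gmul (gsfun a) (gsfun b);
  gsmor_star : forall a, gsfun (gstar a) = gstar (gsfun a);
  gsmor_homog : forall g a, homog g a -> homog g (gsfun a)
}.

Section GSCategory.
Variables (l : inv_ring) (G : groupType).
Implicit Types A B C D : gsalg l G.

Lemma gsmor_ext A B (f g : gsmor A B) : f =1 g -> f = g.
Proof.
case: f => f fM fS fH; case: g => g gM gS gH /= efg.
have e : f = g.
  move: f g efg {fM fS fH gM gS gH}.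
  move=> [f [[f1] [f2]]] [g [[g1] [g2]]] /= /funext e.
  by case: _ / e in g1 g2 *; do !congr GRing.Linear.Pack => //;
     congr GRing.Linear.Class; congr (_ _); exact: Prop_irrelevance.
case: _ / e in gM gS gH *.
by congr GSMor; exact: Prop_irrelevance.
Qed.

Definition gsid A : gsmor A A :=
  @GSMor l G A A idfun (fun _ _ => erefl) (fun _ => erefl) (fun _ _ H => H).

Program Definition gscomp A B C (g : gsmor B C) (f : gsmor A B) : gsmor A C :=
  @GSMor l G A C (g \o f)%FUN _ _ _.
Next Obligation. by move=> A B C g f a b /=; rewrite !gsmorM. Qed.
Next Obligation. by move=> A B C g f a /=; rewrite !gsmor_star. Qed.
Next Obligation. by move=> A B C g f h a ha /=; do 2!apply: gsmor_homog. Qed.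

Program Definition gscat : category :=
  @Category (gsalg l G) (@gsmor l G) gsid gscomp _ _ _.
Next Obligation. by move=> A B f; apply: gsmor_ext. Qed.
Next Obligation. by move=> A B f; apply: gsmor_ext. Qed.
Next Obligation. by move=> A B C D h g f; apply: gsmor_ext. Qed.

End GSCategory.

Section FFam.
Variables (l : inv_ring) (J : choiceType) (M : J -> lmodType l).

Record ffam := FFam {
  ffam_fun :> forall j, M j;
  ffam_fin : finite_set [set j | ffam_fun j != 0]
}.

Lemma ffam_ext (f g : ffam) : (forall j, f j = g j) -> f = g.
Proof.
case: f g => f fP [g gP] /= fg.
have e := functional_extensionality_dep fg; move: fP gP.
by case: _ / e => fP gP; congr FFam; exact: Prop_irrelevance.
Qed.

Lemma finite_sub (A : set J) (s : seq J) :
  (forall j, A j -> j \in s) -> finite_set A.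
Proof. by move=> As; apply: sub_finite_set (finite_seq s) => j /As. Qed.

Lemma ffam_supp (f : ffam) :
  exists2 s : seq J, uniq s & forall j, j \notin s -> f j = 0.
Proof.
have /finite_seqP [s e] := ffam_fin f; exists (undup s); first exact: undup_uniq.
move=> j; rewrite mem_undup => js; apply: contraNeq js => fj.
by have : [set j | f j != 0] j by []; rewrite e.
Qed.

Lemma ffam_fin_of (f : forall j, M j) (s : seq J) :
  (forall j, j \notin s -> f j = 0) -> finite_set [set j | f j != 0].
Proof. by move=> fs; apply: (@finite_sub _ s) => j; apply: contraNT => /fs ->. Qed.

HB.instance Definition _ := gen_eqMixin ffam.
HB.instance Definition _ := gen_choiceMixin ffam.

Program Definition ffam0 : ffam := @FFam (fun=> 0) _.
Next Obligation. exact: (@ffam_fin_of _ [::]). Qed.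

Program Definition ffamN (f : ffam) : ffam := @FFam (fun j => - f j) _.
Next Obligation.
move=> f; have [s _ fs] := ffam_supp f.
by apply: (@ffam_fin_of _ s) => j /fs ->; rewrite oppr0.
Qed.

Program Definition ffamD (f g : ffam) : ffam := @FFam (fun j => f j + g j) _.
Next Obligation.
move=> f g; have [s _ fs] := ffam_supp f; have [t _ gt] := ffam_supp g.
apply: (@ffam_fin_of _ (s ++ t)) => j; rewrite mem_cat negb_or.
by case/andP=> /fs -> /gt ->; rewrite addr0.
Qed.

Program Definition ffamZ (k : l) (f : ffam) : ffam := @FFam (fun j => k *: f j) _.
Next Obligation.
move=> k f; have [s _ fs] := ffam_supp f.
by apply: (@ffam_fin_of _ s) => j /fs ->; rewrite scaler0.
Qed.

Fact ffam_addA : associative ffamD.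
Proof. by move=> f g h; apply: ffam_ext => j; apply: addrA. Qed.
Fact ffam_addC : commutative ffamD.
Proof. by move=> f g; apply: ffam_ext => j; apply: addrC. Qed.
Fact ffam_add0 : left_id ffam0 ffamD.
Proof. by move=> f; apply: ffam_ext => j; apply: add0r. Qed.
Fact ffam_addN : left_inverse ffam0 ffamN ffamD.
Proof. by move=> f; apply: ffam_ext => j; apply: addNr. Qed.

HB.instance Definition _ :=
  GRing.isZmodule.Build ffam ffam_addA ffam_addC ffam_add0 ffam_addN.

Fact ffam_scaleA a b (f : ffam) : ffamZ a (ffamZ b f) = ffamZ (a * b) f.
Proof. by apply: ffam_ext => j; apply: scalerA. Qed.
Fact ffam_scale1 : left_id 1 ffamZ.
Proof. by move=> f; apply: ffam_ext => j; apply: scale1r. Qed.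
Fact ffam_scaleDr : right_distributive ffamZ +%R.
Proof. by move=> a f g; apply: ffam_ext => j; apply: scalerDr. Qed.
Fact ffam_scaleDl f : {morph ffamZ^~ f : a b / a + b}.
Proof. by move=> a b; apply: ffam_ext => j; apply: scalerDl. Qed.

HB.instance Definition _ := GRing.Zmodule_isLmodule.Build l ffam
  ffam_scaleA ffam_scale1 ffam_scaleDr ffam_scaleDl.

Lemma ffamDE (f g : ffam) j : (f + g) j = f j + g j. Proof. by []. Qed.
Lemma ffamZE k (f : ffam) j : (k *: f) j = k *: f j. Proof. by []. Qed.

Lemma ffam_sumE (I : Type) (r : seq I) (P : pred I) (F : I -> ffam) j :
  (\sum_(i <- r | P i) F i) j = \sum_(i <- r | P i) F i j.
Proof. by elim/big_rec2: _ => // i x y _ <-. Qed.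

(* The family with value [x] at [j] and zero elsewhere. *)
Definition single_fun j (x : M j) : forall i, M i := fun i =>
  match pselect (j = i) with
  | left e => ecast i (M i) e x
  | right _ => 0
  end.

Lemma single_funE j (x : M j) : single_fun x j = x.
Proof.
rewrite /single_fun; case: pselect => // e.
by rewrite (Prop_irrelevance e erefl).
Qed.

Lemma single_fun0 j (x : M j) i : j <> i -> single_fun x i = 0.
Proof. by rewrite /single_fun; case: pselect. Qed.

Program Definition single j (x : M j) : ffam := @FFam (single_fun x) _.
Next Obligation.
move=> j x; apply: (@ffam_fin_of _ [:: j]) => i; rewrite inE => /eqP ij.
by apply: single_fun0 => ji; apply: ij.
Qed.

Lemma single_linear j : linear (@single j).
Proof.
move=> k x y; apply: ffam_ext => i; rewrite ffamDE ffamZE /=.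
have [<-|ji] := pselect (j = i); first by rewrite !single_funE.
by rewrite !single_fun0 // scaler0 addr0.
Qed.

HB.instance Definition _ j :=
  GRing.isLinear.Build l (M j) ffam _ (@single j) (@single_linear j).

Lemma ffam_decomp (f : ffam) (s : seq J) : uniq s ->
  (forall j, j \notin s -> f j = 0) -> f = \sum_(j <- s) single (f j).
Proof.
move=> us fs; apply: ffam_ext => i; rewrite ffam_sumE.
have [si|/fs fi0] := boolP (i \in s).
  rewrite (bigD1_seq i) // [X in _ = X + _]single_funE big1 ?addr0 // => j /eqP ji.
  exact: single_fun0.
rewrite fi0 big1_seq // => j /andP[_ js]; have [e|/eqP ji] := eqVneq j i.
  by rewrite -e in fi0 *; rewrite fi0; apply: single_funE.
exact: single_fun0.
Qed.

End FFam.

Definition hspan (l : inv_ring) (G : Type) (V : lmodType l)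
    (h : G -> V -> Prop) (a : V) : Prop :=
  exists2 r : seq V, (forall b, b \in r -> exists g, h g b) & a = \sum_(b <- r) b.

Section HSpan.
Variables (l : inv_ring) (G : Type) (V : lmodType l) (h : G -> V -> Prop).

Lemma hspan0 : hspan h 0.
Proof. by exists [::]; rewrite ?big_nil. Qed.

Lemma hspan1 g a : h g a -> hspan h a.
Proof.
by exists [:: a]; rewrite ?big_seq1 // => b; rewrite inE => /eqP ->; exists g.
Qed.

Lemma hspanD a b : hspan h a -> hspan h b -> hspan h (a + b).
Proof.
move=> [r rh ->] [s sh ->]; exists (r ++ s); last by rewrite big_cat.
by move=> x; rewrite mem_cat => /orP[/rh|/sh].
Qed.

Lemma hspan_sum (I : eqType) (r : seq I) (F : I -> V) :
  (forall i, i \in r -> hspan h (F i)) -> hspan h (\sum_(i <- r) F i).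
Proof.
move=> rF; rewrite big_seq; elim/big_rec: _ => [|i x ir hx]; first exact: hspan0.
by apply: hspanD => //; apply: rF.
Qed.

Lemma hspan_map (W : lmodType l) (k : G -> W -> Prop) (f : W -> V) a :
  {morph f : x y / x + y} -> f 0 = 0 ->
  (forall g x, k g x -> hspan h (f x)) -> hspan k a -> hspan h (f a).
Proof.
move=> fD f0 kf [r rh ->]; rewrite (big_morph f fD f0); apply: hspan_sum => b br.
by have [g /kf] := rh b br; apply.
Qed.

End HSpan.

Section GSum.
Variables (l : inv_ring) (G : groupType) (J : choiceType) (A : J -> gsalg l G).
Local Notation M := (ffam (fun j => A j : lmodType l)).
Implicit Types f : M.

Lemma gmul0l (B : gsalg l G) (b : B) : gmul 0 b = 0.
Proof. by apply: (addIr (gmul 0 b)); rewrite -gmulDl !add0r. Qed.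
Lemma gmul0r (B : gsalg l G) (b : B) : gmul b 0 = 0.
Proof. by apply: (addIr (gmul b 0)); rewrite -gmulDr !add0r. Qed.
Lemma gstar0 (B : gsalg l G) : gstar 0 = 0 :> B.
Proof. by apply: (addIr (gstar (0 : B))); rewrite -gstarD !add0r. Qed.

Lemma gmul_suml (B : gsalg l G) (I : Type) (r : seq I) (F : I -> B) (b : B) :
  gmul (\sum_(i <- r) F i) b = \sum_(i <- r) gmul (F i) b.
Proof.
by elim/big_rec2: _ => [|i x y _ <-]; [apply: gmul0l|apply: gmulDl].
Qed.
Lemma gmul_sumr (B : gsalg l G) (I : Type) (r : seq I) (F : I -> B) (b : B) :
  gmul b (\sum_(i <- r) F i) = \sum_(i <- r) gmul b (F i).
Proof.
by elim/big_rec2: _ => [|i x y _ <-]; [apply: gmul0r|apply: gmulDr].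
Qed.
Lemma gstar_sum (B : gsalg l G) (I : Type) (r : seq I) (F : I -> B) :
  gstar (\sum_(i <- r) F i) = \sum_(i <- r) gstar (F i).
Proof.
by elim/big_rec2: _ => [|i x y _ <-]; [apply: gstar0|apply: gstarD].
Qed.

Program Definition gsum_mul (f g : M) : M := @FFam _ _ _ (fun j => gmul (f j) (g j)) _.
Next Obligation.
move=> f g; have [s _ fs] := ffam_supp f.
by apply: (@ffam_fin_of _ _ _ _ s) => j /fs ->; rewrite gmul0l.
Qed.

Program Definition gsum_star (f : M) : M := @FFam _ _ _ (fun j => gstar (f j)) _.
Next Obligation.
move=> f; have [s _ fs] := ffam_supp f.
by apply: (@ffam_fin_of _ _ _ _ s) => j /fs ->; rewrite gstar0.
Qed.

Definition gsum_homog (g : G) (f : M) : Prop := forall j, homog g (f j).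

Lemma single_homog j g (a : A j) : homog g a -> gsum_homog g (single a).
Proof.
move=> ga i; rewrite /=; have [<-|ji] := pselect (j = i).
  by rewrite single_funE.
by rewrite single_fun0 //; apply: homog0.
Qed.

Program Definition gsum : gsalg l G :=
  @GSAlg l G M gsum_mul gsum_star gsum_homog _ _ _ _ _ _ _ _ _ _ _ _ _ _ _ _.
Next Obligation. by move=> f g h; apply: ffam_ext => j; apply: gmulA. Qed.
Next Obligation. by move=> f g h; apply: ffam_ext => j; apply: gmulDl. Qed.
Next Obligation. by move=> f g h; apply: ffam_ext => j; apply: gmulDr. Qed.
Next Obligation. by move=> *; apply: ffam_ext => j; apply: gmulZl. Qed.
Next Obligation. by move=> *; apply: ffam_ext => j; apply: gmulZr. Qed.
Next Obligation. by move=> *; apply: ffam_ext => j; apply: gstarD. Qed.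
Next Obligation. by move=> *; apply: ffam_ext => j; apply: gstarM. Qed.
Next Obligation. by move=> *; apply: ffam_ext => j; apply: gstarZ. Qed.
Next Obligation. by move=> *; apply: ffam_ext => j; apply: gstarK. Qed.
Next Obligation. by move=> g j; apply: homog0. Qed.
Next Obligation. by move=> g a b ga gb j; apply: homogD. Qed.
Next Obligation. by move=> g k a ga j; apply: homogZ. Qed.
Next Obligation. by move=> g h a b ga hb j; apply: homogM. Qed.
Next Obligation. by move=> g a ga j; apply: homog_star. Qed.
Next Obligation.
move=> f; have [s us fs] := ffam_supp f.
rewrite (ffam_decomp us fs); apply: hspan_sum => j _.
apply: (hspan_map (k := @homog _ _ (A j))); last exact: homog_span.
- exact: linearD.
- exact: linear0.
- by move=> g x gx; apply: hspan1 (single_homog gx).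
Qed.
Next Obligation.
move=> s c us hc c0 g gs; apply: ffam_ext => j.
apply: (@homog_indep _ _ _ s (fun g => c g j)) => //; first by move=> h; apply: hc.
by rewrite -ffam_sumE c0.
Qed.

Program Definition gsum_in j : gsmor (A j) gsum :=
  @GSMor l G (A j) gsum (@single _ _ _ j) _ _ (@single_homog j).
Next Obligation.
move=> j a b; apply: ffam_ext => i /=; have [<-|ji] := pselect (j = i).
  by rewrite !single_funE.
by rewrite !single_fun0 // gmul0l.
Qed.
Next Obligation.
move=> j a; apply: ffam_ext => i /=; have [<-|ji] := pselect (j = i).
  by rewrite !single_funE.
by rewrite !single_fun0 // gstar0.
Qed.

End GSum.

Section Base.
Variables (l : inv_ring) (G : groupType).

Definition base_homog (g : G) (a : l^o) : Prop := g = 1%g \/ a = 0.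

Program Definition gbase : gsalg l G :=
  @GSAlg l G l^o *%R (rconj l) base_homog _ _ _ _ _ _ _ _ _ _ _ _ _ _ _ _.
Next Obligation. exact: mulrA. Qed.
Next Obligation. exact: mulrDl. Qed.
Next Obligation. exact: mulrDr. Qed.
Next Obligation. by move=> k a b; apply: esym (mulrA k a b). Qed.
Next Obligation. by move=> k a b; apply: (mulrCA a k b). Qed.
Next Obligation. exact: rmorphD. Qed.
Next Obligation. by move=> a b; rewrite rmorphM mulrC. Qed.
Next Obligation. by move=> k a; apply: rmorphM. Qed.
Next Obligation. exact: rconjK. Qed.
Next Obligation. by move=> g; right. Qed.
Next Obligation.
move=> g a b [->|->]; first by left.
by case=> [->|->]; [left|right; rewrite addr0].
Qed.
Next Obligation. by move=> g k a [->|->]; [left|right; rewrite scaler0]. Qed.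
Next Obligation.
move=> g h a b [->|->]; last by right; rewrite mul0r.
by case=> [->|->]; [left; rewrite mulg1|right; rewrite mulr0].
Qed.
Next Obligation.
by move=> g a [->|->]; [left; rewrite invg1|right; rewrite rmorph0].
Qed.
Next Obligation. by move=> a; apply: (@hspan1 _ _ _ _ 1%g); left. Qed.
Next Obligation.
move=> s c us hc c0 g gs; case: (hc g) => // e; rewrite e in gs *.
rewrite -[RHS]c0 (bigD1_seq 1%g) //= big1 ?addr0 // => h /eqP h1.
by case: (hc h).
Qed.

(* As a direct sum of copies of [l] this is the set of finitely supported
   functions on [S], with pointwise operations and trivial grading. *)
Definition gfun (S : choiceType) : gsalg l G := gsum (fun _ : S => gbase).

Definition chi (S : choiceType) (v : S) : gfun S := gsum_in (fun=> gbase) v (1 : l).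

End Base.

Record gset (G : groupType) := GSet {
  gset_sort :> choiceType;
  gdeg : gset_sort -> G
}.

Definition gset_sum (G : groupType) (X Y : gset G) : gset G :=
  @GSet G (X + Y)%type
    (fun z => match z with inl x => gdeg x | inr y => gdeg y end).

Lemma fsum_seq (J : choiceType) (V : nmodType) (F : J -> V) (s : seq J) :
  uniq s -> (forall y, y \notin s -> F y = 0) ->
  \sum_(y \in [set: J]) F y = \sum_(y <- s) F y.
Proof.
move=> us sF; rewrite (fsbigE s) //; last by move=> y _; apply: sF.
by apply: eq_bigl => y; rewrite in_setT.
Qed.

Section GMat.
Variables (l : inv_ring) (G : groupType).

Section Ops.
Variables (X : gset G) (A : gsalg l G).
Local Notation M := (ffam (fun _ : (X * X)%type => A : lmodType l)).
Implicit Types (f g h : M) (s t : seq X).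

Definition mbound s f := forall x y, ~~ ((x \in s) && (y \in s)) -> f (x, y) = 0.

Lemma mbound_sub s t f : {subset s <= t} -> mbound s f -> mbound t f.
Proof.
move=> st sf x y xy; apply: sf; apply: contra xy => /andP[xs ys].
by rewrite !st.
Qed.

Lemma mboundP f : exists s, mbound s f.
Proof.
have [s _ sf] := ffam_supp f; exists (map fst s ++ map snd s) => x y xy.
apply: sf; apply: contra xy => xys; rewrite !mem_cat.
by rewrite (map_f fst xys) (map_f snd xys) orbT.
Qed.

Lemma mbound3 f g h : exists s, [/\ uniq s, mbound s f, mbound s g & mbound s h].
Proof.
have [s1 fs] := mboundP f; have [s2 gs] := mboundP g; have [s3 hs] := mboundP h.
exists (undup (s1 ++ s2 ++ s3)); split; first exact: undup_uniq.
- by apply: mbound_sub fs => x; rewrite mem_undup !mem_cat => ->.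
- by apply: mbound_sub gs => x; rewrite mem_undup !mem_cat => ->; rewrite orbT.
- by apply: mbound_sub hs => x; rewrite mem_undup !mem_cat => ->; rewrite !orbT.
Qed.

Lemma mbound_fin (F : X * X -> A) s :
  (forall x y, ~~ ((x \in s) && (y \in s)) -> F (x, y) = 0) ->
  finite_set [set p | F p != 0].
Proof.
move=> sF; apply: (@ffam_fin_of _ _ _ _ [seq (x, y) | x <- s, y <- s]).
move=> [x y] /= xy; apply: sF; apply: contra xy => /andP[xs ys].
by apply/allpairsP; exists (x, y).
Qed.

Definition mmul_fun f g : X * X -> A :=
  fun p => \sum_(y \in [set: X]) gmul (f (p.1, y)) (g (y, p.2)).

Lemma mmul_funl f g s x y : uniq s -> mbound s f ->
  mmul_fun f g (x, y) = \sum_(z <- s) gmul (f (x, z)) (g (z, y)).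
Proof.
move=> us fs; apply: fsum_seq => // z zs.
by rewrite fs ?gmul0l // negb_and zs orbT.
Qed.

Lemma mmul_funr f g s x y : uniq s -> mbound s g ->
  mmul_fun f g (x, y) = \sum_(z <- s) gmul (f (x, z)) (g (z, y)).
Proof.
move=> us gs; apply: fsum_seq => // z zs.
by rewrite gs ?gmul0r // negb_and zs.
Qed.

Lemma mmul_bound f g s : uniq s -> mbound s f -> mbound s g ->
  forall x y, ~~ ((x \in s) && (y \in s)) -> mmul_fun f g (x, y) = 0.
Proof.
move=> us fs gs x y; rewrite negb_and => /orP xy.
rewrite (mmul_funl _ _ _ us fs) big1 // => z _; case: xy => [xs|ys].
  by rewrite fs ?gmul0l // negb_and xs.
by rewrite gs ?gmul0r // negb_and ys orbT.
Qed.

Program Definition mmul f g : M := @FFam _ _ _ (mmul_fun f g) _.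
Next Obligation.
move=> f g; have [s [us fs gs _]] := mbound3 f g 0.
exact: mbound_fin (mmul_bound us fs gs).
Qed.

Program Definition mstar f : M := @FFam _ _ _ (fun p => gstar (f (p.2, p.1))) _.
Next Obligation.
move=> f; have [s fs] := mboundP f; apply: (@mbound_fin _ s) => x y xy /=.
by rewrite fs ?gstar0 // andbC.
Qed.

(* [mhomog g f] says that each entry [f (x, y)] is homogeneous of the degree
   [d] such that [gdeg x * d * (gdeg y)^-1 = g]. *)
Definition mhomog (g : G) f : Prop :=
  forall x y : X, homog ((gdeg x)^-1 * g * gdeg y)%g (f (x, y)).

Lemma mmulE f g x y : mmul f g (x, y) = mmul_fun f g (x, y). Proof. by []. Qed.

Lemma mmulA : associative mmul.
Proof.
move=> f g h; apply: ffam_ext => -[x t]; have [s [us fs gs hs]] := mbound3 f g h.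
rewrite !mmulE (mmul_funl _ _ _ us fs) (mmul_funr _ _ _ us hs).
under eq_bigr => z _ do
  rewrite mmulE (mmul_funl _ _ _ us gs) gmul_sumr.
rewrite exchange_big /=; apply: eq_bigr => z _.
rewrite (mmul_funl _ _ _ us fs).
rewrite gmul_suml.
by apply: eq_bigr => y _; rewrite gmulA.
Qed.

Lemma mmulDl : left_distributive mmul +%R.
Proof.
move=> f g h; apply: ffam_ext => -[x t]; have [s [us fs gs hs]] := mbound3 f g h.
rewrite ffamDE !mmulE !(mmul_funr _ _ _ us hs) -big_split.
by apply: eq_bigr => z _; rewrite ffamDE gmulDl.
Qed.

Lemma mmulDr : right_distributive mmul +%R.
Proof.
move=> f g h; apply: ffam_ext => -[x t]; have [s [us fs gs hs]] := mbound3 f g h.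
rewrite ffamDE !mmulE !(mmul_funl _ _ _ us fs) -big_split.
by apply: eq_bigr => z _; rewrite ffamDE gmulDr.
Qed.

Lemma mmulZl (k : l) f g : mmul (k *: f) g = k *: mmul f g.
Proof.
apply: ffam_ext => -[x t]; have [s [us fs gs _]] := mbound3 f g 0.
rewrite ffamZE !mmulE !(mmul_funr _ _ _ us gs) scaler_sumr.
by apply: eq_bigr => z _; rewrite ffamZE gmulZl.
Qed.

Lemma mmulZr (k : l) f g : mmul f (k *: g) = k *: mmul f g.
Proof.
apply: ffam_ext => -[x t]; have [s [us fs gs _]] := mbound3 f g 0.
rewrite ffamZE !mmulE !(mmul_funl _ _ _ us fs) scaler_sumr.
by apply: eq_bigr => z _; rewrite ffamZE gmulZr.
Qed.

Lemma mstarM f g : mstar (mmul f g) = mmul (mstar g) (mstar f).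
Proof.
apply: ffam_ext => -[x t]; have [s [us fs gs _]] := mbound3 f g 0.
have gs' : mbound s (mstar g) by move=> y z yz; rewrite /= gs ?gstar0 // andbC.
rewrite mmulE (mmul_funl _ _ _ us gs').
rewrite [LHS]/= (mmul_funl _ _ _ us fs) gstar_sum.
by apply: eq_bigr => z _; rewrite gstarM.
Qed.

Lemma homog_sum (B : gsalg l G) (g : G) (I : Type) (r : seq I) (F : I -> B) :
  (forall i, homog g (F i)) -> homog g (\sum_(i <- r) F i).
Proof.
by move=> gF; elim/big_rec: _ => [|i x _ gx]; [apply: homog0|apply: homogD].
Qed.

Lemma mhomogM (g h : G) (a b : M) : mhomog g a -> mhomog h b -> mhomog (g * h)%g (mmul a b).
Proof.
move=> ga hb x y; have [s [us as_ _ _]] := mbound3 a 0 0.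
rewrite mmulE (mmul_funl _ _ _ us as_); apply: homog_sum => z.
have -> : ((gdeg x)^-1 * (g * h) * gdeg y =
    ((gdeg x)^-1 * g * gdeg z) * ((gdeg z)^-1 * h * gdeg y))%g.
  by rewrite !mulgA mulgK.
exact: homogM.
Qed.

Lemma mhomog_star (g : G) (a : M) : mhomog g a -> mhomog (g^-1)%g (mstar a).
Proof.
move=> ga x y /=; have /homog_star := ga y x.
by rewrite !invgM invgK !mulgA.
Qed.

Lemma mhomog_span f : hspan mhomog f.
Proof.
have [s us fs] := ffam_supp f; rewrite (ffam_decomp us fs).
apply: hspan_sum => -[x y] _.
apply: (hspan_map (k := @homog _ _ A)); last exact: homog_span.
- exact: linearD.
- exact: linear0.
move=> g a ga; apply: (@hspan1 _ _ _ _ (gdeg x * g * (gdeg y)^-1)%g) => z t /=.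
have [[<- <-]|ne] := pselect ((x, y) = (z, t)).
  by rewrite single_funE !mulgA mulVg mul1g mulgVK.
by rewrite single_fun0 //; apply: homog0.
Qed.

Lemma mhomog_indep (s : seq G) (c : G -> M) : uniq s ->
  (forall g : G, mhomog g (c g)) -> \sum_(g <- s) c g = 0 ->
  forall g : G, g \in s -> c g = 0.
Proof.
move=> us hc c0 g gs; apply: ffam_ext => -[x y].
pose k (h : G) := ((gdeg x)^-1 * h * gdeg y)%g.
pose k' (h : G) := (gdeg x * h * (gdeg y)^-1)%g.
have kK : cancel k k' by move=> h; rewrite /k /k' !mulgA mulgV mul1g mulgK.
have k'K : cancel k' k by move=> h; rewrite /k /k' !mulgA mulVg mul1g mulgVK.
have := @homog_indep _ _ A (map k s) (fun h : G => c (k' h) (x, y)).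
move/(_ _ _ _ (k g)); rewrite kK; apply.
- by rewrite map_inj_uniq //; apply: can_inj kK.
- by move=> h; have := hc (k' h) x y; rewrite -/(k _) k'K.
- rewrite big_map; under eq_bigr do rewrite kK.
  by rewrite -(ffam_sumE s xpredT) c0.
- exact: map_f.
Qed.

Program Definition gmat : gsalg l G :=
  @GSAlg l G M mmul mstar mhomog mmulA mmulDl mmulDr mmulZl mmulZr
    _ mstarM _ _ _ _ _ mhomogM mhomog_star mhomog_span mhomog_indep.
Next Obligation. by move=> f g; apply: ffam_ext => p; apply: gstarD. Qed.
Next Obligation. by move=> k f; apply: ffam_ext => p; apply: gstarZ. Qed.
Next Obligation. by move=> f; apply: ffam_ext => -[x y]; apply: gstarK. Qed.
Next Obligation. by move=> g x y; apply: homog0. Qed.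
Next Obligation. by move=> g a b ga gb x y; apply: homogD. Qed.
Next Obligation. by move=> g k a ga x y; apply: homogZ. Qed.

End Ops.

Section Inclusion.
Variables (X Y : gset G) (A : gsalg l G).
Local Notation XY := (gset_sum X Y).

Definition mat_incl_entry (f : gmat X A) (p : XY * XY) : A :=
  match p with (inl x, inl y) => (f : ffam _) (x, y) | _ => 0 end.

Program Definition mat_incl_fun (f : gmat X A) : gmat XY A :=
  @FFam _ _ _ (mat_incl_entry f) _.
Next Obligation.
move=> f; have [s fs] := mboundP f; apply: (@mbound_fin XY A _ (map inl s)).
move=> [x|x] [y|y] //= xy; apply: fs; apply: contra xy.
by rewrite !(mem_map (@inl_inj _ _)).
Qed.

Lemma mat_incl_linear : linear mat_incl_fun.
Proof.
by move=> k f g; apply: ffam_ext => -[[x|x] [y|y]];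
   rewrite ffamDE ffamZE //= scaler0 addr0.
Qed.
HB.instance Definition _ :=
  GRing.isLinear.Build l (gmat X A) (gmat XY A) _ mat_incl_fun mat_incl_linear.

Program Definition mat_incl : gsmor (gmat X A) (gmat XY A) :=
  @GSMor l G _ _ mat_incl_fun _ _ _.
Next Obligation.
move=> f g; apply: ffam_ext; have [s [us fs gs _]] := mbound3 f g 0.
pose s' : seq XY := map inl s.
have us' : uniq s' by rewrite map_inj_uniq //; apply: inl_inj.
have fs' : @mbound XY A s' (mat_incl_fun f).
  move=> [x|x] [y|y] //= xy; apply: fs; apply: contra xy.
  by rewrite !(mem_map (@inl_inj _ _)).
move=> [x y]; rewrite [RHS](mmul_funl _ _ _ us' fs') big_map.
case: x y => [x|x] [y|y] /=; first exact: mmul_funl.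
- by rewrite big1 // => z _; rewrite gmul0r.
- by rewrite big1 // => z _; rewrite gmul0l.
- by rewrite big1 // => z _; rewrite gmul0l.
Qed.
Next Obligation.
by move=> f; apply: ffam_ext => -[[x|x] [y|y]] //=; rewrite gstar0.
Qed.
Next Obligation.
by move=> g f gf [x|x] [y|y]; [exact: (gf x y) | exact: homog0..].
Qed.

End Inclusion.

Section PlusMinus.
Variable A : gsalg l G.

Definition gset2 : gset G := @GSet G 'I_2 (fun=> 1%g).

(* The entries of [h x^* h] for [h = diag(1, -1)]. *)
Definition pm_star_fun (f : gmat gset2 A) (p : gset2 * gset2) : A :=
  ((-1) ^+ val p.1 * (-1) ^+ val p.2 : l) *: mstar f p.

Program Definition pm_star (f : gmat gset2 A) : gmat gset2 A :=
  @FFam _ _ _ (pm_star_fun f) _.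
Next Obligation.
move=> f; have [s _ fs] := ffam_supp (mstar f).
apply: (@ffam_fin_of _ _ _ _ s) => p /fs p0.
by rewrite /pm_star_fun p0 scaler0.
Qed.

Lemma rconj_sign n : rconj l ((-1) ^+ n) = (-1) ^+ n.
Proof. by rewrite rmorphXn rmorphN1. Qed.

Lemma sign_sqr n : (-1) ^+ n * (-1) ^+ n = 1 :> l.
Proof. by rewrite -expr2 sqrr_sign. Qed.

Program Definition gmat_pm : gsalg l G :=
  @GSAlg l G (gmat gset2 A) (@gmul _ _ (gmat gset2 A)) pm_star
    (@homog _ _ (gmat gset2 A))
    (@gmulA _ _ (gmat gset2 A)) (@gmulDl _ _ (gmat gset2 A))
    (@gmulDr _ _ (gmat gset2 A)) (@gmulZl _ _ (gmat gset2 A))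
    (@gmulZr _ _ (gmat gset2 A)) _ _ _ _
    (@homog0 _ _ (gmat gset2 A)) (@homogD _ _ (gmat gset2 A))
    (@homogZ _ _ (gmat gset2 A)) (@homogM _ _ (gmat gset2 A)) _
    (@homog_span _ _ (gmat gset2 A)) (@homog_indep _ _ (gmat gset2 A)).
Next Obligation.
move=> f g; apply: ffam_ext => p; rewrite ffamDE /= /pm_star_fun -scalerDr.
by congr (_ *: _); apply: gstarD.
Qed.
Next Obligation.
move=> f g; apply: ffam_ext => -[x y]; have [s [us fs gs _]] := mbound3 f g 0.
have gs' : mbound s (pm_star g).
  by move=> a b ab; rewrite /= /pm_star_fun /= gs ?gstar0 ?scaler0 // andbC.
rewrite [RHS](mmul_funl _ _ _ us gs') /= /pm_star_fun /=.
rewrite (mmul_funl _ _ _ us fs) gstar_sum.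
rewrite scaler_sumr; apply: eq_bigr => z _ /=.
rewrite /pm_star_fun /= gmulZl gmulZr scalerA gstarM; congr (_ *: _).
by rewrite [X in _ = X * _]mulrC mulrACA sign_sqr mul1r.
Qed.
Next Obligation.
move=> k f; apply: ffam_ext => p; rewrite ffamZE /= /pm_star_fun.
by rewrite /= gstarZ !scalerA mulrC.
Qed.
Next Obligation.
move=> f; apply: ffam_ext => -[x y] /=; rewrite /pm_star_fun /= /pm_star_fun /=.
rewrite gstarZ gstarK rmorphM !rconj_sign scalerA.
by rewrite [X in _ * X]mulrC mulrACA !sign_sqr mulr1 scale1r.
Qed.
Next Obligation.
move=> g f gf x y; rewrite /= /pm_star_fun; apply: homogZ.
exact: (mhomog_star gf x y).
Qed.

Program Definition corner_pm : gsmor A gmat_pm :=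
  @GSMor l G A gmat_pm
    (@single l (gset2 * gset2)%type (fun=> A : lmodType l) (ord0, ord0)) _ _ _.
Next Obligation.
move=> a b; apply: ffam_ext => -[x y].
pose S := @single l (gset2 * gset2)%type (fun=> A : lmodType l) (ord0, ord0).
have Sb (c : A) : @mbound gset2 A [:: ord0] (S c).
  move=> z t; rewrite !inE => zt; apply: single_fun0 => -[ez et].
  by rewrite -ez -et !eqxx in zt.
rewrite [RHS](mmul_funl _ _ _ _ (Sb a)) // big_seq1 /=.
have [[<- <-]|ne] := pselect ((ord0, ord0) = (x, y) :> 'I_2 * 'I_2).
  by rewrite !single_funE.
rewrite single_fun0 //.
have [e|/eqP x0] := eqVneq ord0 x; last by rewrite single_fun0 ?gmul0l // => -[].
have [e'|/eqP y0] := eqVneq ord0 y; last first.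
  by rewrite [X in gmul _ X]single_fun0 ?gmul0r // => -[].
by case: ne; rewrite -e' -e.
Qed.
Next Obligation.
move=> a; apply: ffam_ext => -[x y]; rewrite /= /pm_star_fun /=.
have [[<- <-]|ne] := pselect ((ord0, ord0) = (x, y) :> 'I_2 * 'I_2).
  by rewrite !single_funE !expr0 mulr1 scale1r.
rewrite !single_fun0 ?gstar0 ?scaler0 //.
by move=> [e1 e2]; apply: ne; rewrite -e1 -e2.
Qed.
Next Obligation.
move=> g a ga x y /=.
rewrite invg1 mul1g mulg1.
have [e|ne] := pselect ((ord0, ord0) = (x, y) :> 'I_2 * 'I_2).
  by case: _ / e; rewrite single_funE.
by rewrite single_fun0 //; apply: homog0.
Qed.

End PlusMinus.
End GMat.

Section Presentation.
Variables (l : inv_ring) (X : Type).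

Inductive tm : Type :=
| tgen of X
| tzero
| tadd of tm & tm
| topp of tm
| tscale of l & tm
| tmul of tm & tm.

HB.instance Definition _ := gen_eqMixin tm.
HB.instance Definition _ := gen_choiceMixin tm.

Variable R : tm -> tm -> Prop.

(* The least congruence which contains [R] and makes the quotient an
   associative, not necessarily unital, [l]-algebra. *)
Inductive tmeq : tm -> tm -> Prop :=
| te_rel t u : R t u -> tmeq t u
| te_refl t : tmeq t t
| te_sym t u : tmeq t u -> tmeq u t
| te_trans t u v : tmeq t u -> tmeq u v -> tmeq t v
| te_add t t' u u' : tmeq t t' -> tmeq u u' -> tmeq (tadd t u) (tadd t' u')
| te_opp t t' : tmeq t t' -> tmeq (topp t) (topp t')
| te_scale k t t' : tmeq t t' -> tmeq (tscale k t) (tscale k t')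
| te_mul t t' u u' : tmeq t t' -> tmeq u u' -> tmeq (tmul t u) (tmul t' u')
| te_addA t u v : tmeq (tadd t (tadd u v)) (tadd (tadd t u) v)
| te_addC t u : tmeq (tadd t u) (tadd u t)
| te_add0 t : tmeq (tadd tzero t) t
| te_addN t : tmeq (tadd (topp t) t) tzero
| te_scaleA j k t : tmeq (tscale j (tscale k t)) (tscale (j * k) t)
| te_scale1 t : tmeq (tscale 1 t) t
| te_scaleDr k t u : tmeq (tscale k (tadd t u)) (tadd (tscale k t) (tscale k u))
| te_scaleDl j k t : tmeq (tscale (j + k) t) (tadd (tscale j t) (tscale k t))
| te_mulA t u v : tmeq (tmul t (tmul u v)) (tmul (tmul t u) v)
| te_mulDl t u v : tmeq (tmul (tadd t u) v) (tadd (tmul t v) (tmul u v))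
| te_mulDr t u v : tmeq (tmul t (tadd u v)) (tadd (tmul t u) (tmul t v))
| te_mulZl k t u : tmeq (tmul (tscale k t) u) (tscale k (tmul t u))
| te_mulZr k t u : tmeq (tmul t (tscale k u)) (tscale k (tmul t u)).

Definition tmeqb (t u : tm) : bool := `[< tmeq t u >].

Fact tmeqb_refl : reflexive tmeqb.
Proof. by move=> t; apply/asboolP; apply: te_refl. Qed.
Fact tmeqb_sym : symmetric tmeqb.
Proof. by move=> t u; apply/asboolP/asboolP; apply: te_sym. Qed.
Fact tmeqb_trans : transitive tmeqb.
Proof.
by move=> u t v /asboolP tu /asboolP uv; apply/asboolP; apply: te_trans uv.
Qed.

Canonical tmeq_equiv : equiv_rel tm :=
  EquivRel tmeqb tmeqb_refl tmeqb_sym tmeqb_trans.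

Definition pres : Type := {eq_quot tmeq_equiv}%qT.
HB.instance Definition _ := Choice.on pres.

Definition tclass (t : tm) : pres := (\pi_({eq_quot tmeq_equiv}) t)%qT.
Definition trepr (a : pres) : tm := repr (a : {eq_quot tmeq_equiv}%qT).

Lemma tclassP t u : tclass t = tclass u <-> tmeq t u.
Proof.
split=> [e|/asboolP tu]; last exact/eqquotP.
by apply/asboolP; move/eqquotP: e.
Qed.

Lemma treprK a : tclass (trepr a) = a. Proof. exact: reprK. Qed.
Lemma trepr_class t : tmeq (trepr (tclass t)) t.
Proof. by apply/tclassP; apply: treprK. Qed.

Definition pgen (x : X) : pres := tclass (tgen x).
Definition pzero : pres := tclass tzero.
Definition padd (a b : pres) : pres := tclass (tadd (trepr a) (trepr b)).
Definition popp (a : pres) : pres := tclass (topp (trepr a)).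
Definition pscale (k : l) (a : pres) : pres := tclass (tscale k (trepr a)).
Definition pmul (a b : pres) : pres := tclass (tmul (trepr a) (trepr b)).

Lemma tclass_rawD t u : tclass (tadd t u) = padd (tclass t) (tclass u).
Proof. by apply/tclassP/te_add; apply/te_sym/trepr_class. Qed.
Lemma tclass_rawN t : tclass (topp t) = popp (tclass t).
Proof. by apply/tclassP/te_opp; apply/te_sym/trepr_class. Qed.
Lemma tclass_rawZ k t : tclass (tscale k t) = pscale k (tclass t).
Proof. by apply/tclassP/te_scale; apply/te_sym/trepr_class. Qed.
Lemma tclassM t u : tclass (tmul t u) = pmul (tclass t) (tclass u).
Proof. by apply/tclassP/te_mul; apply/te_sym/trepr_class. Qed.

Lemma tclass_ind (P : pres -> Prop) : (forall t, P (tclass t)) -> forall a, P a.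
Proof. by move=> Pt a; rewrite -(treprK a). Qed.

Fact paddA : associative padd.
Proof.
elim/tclass_ind=> a; elim/tclass_ind=> b; elim/tclass_ind=> c.
by rewrite -!tclass_rawD; apply/tclassP/te_addA.
Qed.
Fact paddC : commutative padd.
Proof.
elim/tclass_ind=> a; elim/tclass_ind=> b.
by rewrite -!tclass_rawD; apply/tclassP/te_addC.
Qed.
Fact padd0 : left_id pzero padd.
Proof. by elim/tclass_ind=> a; rewrite -!tclass_rawD; apply/tclassP/te_add0. Qed.
Fact paddN : left_inverse pzero popp padd.
Proof.
by elim/tclass_ind=> a; rewrite -tclass_rawN -!tclass_rawD; apply/tclassP/te_addN.
Qed.

HB.instance Definition _ := GRing.isZmodule.Build pres paddA paddC padd0 paddN.

Fact pscaleA j k a : pscale j (pscale k a) = pscale (j * k) a.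
Proof.
by elim/tclass_ind: a => a; rewrite -!tclass_rawZ; apply/tclassP/te_scaleA.
Qed.
Fact pscale1 : left_id 1 pscale.
Proof. by elim/tclass_ind=> a; rewrite -!tclass_rawZ; apply/tclassP/te_scale1. Qed.
Fact pscaleDr : right_distributive pscale padd.
Proof.
move=> k; elim/tclass_ind=> a; elim/tclass_ind=> b.
by rewrite -!(tclass_rawD, tclass_rawZ); apply/tclassP/te_scaleDr.
Qed.
Fact pscaleDl a : {morph pscale^~ a : j k / j + k >-> padd j k}.
Proof.
elim/tclass_ind: a => a j k.
by rewrite -!(tclass_rawD, tclass_rawZ); apply/tclassP/te_scaleDl.
Qed.

HB.instance Definition _ :=
  GRing.Zmodule_isLmodule.Build l pres pscaleA pscale1 pscaleDr pscaleDl.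

Lemma tclassD t u : tclass (tadd t u) = tclass t + tclass u.
Proof. exact: tclass_rawD. Qed.
Lemma tclassN t : tclass (topp t) = - tclass t.
Proof. exact: tclass_rawN. Qed.
Lemma tclassZ k t : tclass (tscale k t) = k *: tclass t.
Proof. exact: tclass_rawZ. Qed.

Fact pmulA : associative pmul.
Proof.
elim/tclass_ind=> a; elim/tclass_ind=> b; elim/tclass_ind=> c.
by rewrite -!tclassM; apply/tclassP/te_mulA.
Qed.
Fact pmulDl : left_distributive pmul +%R.
Proof.
elim/tclass_ind=> a; elim/tclass_ind=> b; elim/tclass_ind=> c.
by rewrite -!(tclassD, tclassM); apply/tclassP/te_mulDl.
Qed.
Fact pmulDr : right_distributive pmul +%R.
Proof.
elim/tclass_ind=> a; elim/tclass_ind=> b; elim/tclass_ind=> c.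
by rewrite -!(tclassD, tclassM); apply/tclassP/te_mulDr.
Qed.
Fact pmulZl (k : l) (a b : pres) : pmul (k *: a) b = k *: pmul a b.
Proof.
elim/tclass_ind: a => a; elim/tclass_ind: b => b.
by rewrite -!(tclassZ, tclassM); apply/tclassP/te_mulZl.
Qed.
Fact pmulZr (k : l) (a b : pres) : pmul a (k *: b) = k *: pmul a b.
Proof.
elim/tclass_ind: a => a; elim/tclass_ind: b => b.
by rewrite -!(tclassZ, tclassM); apply/tclassP/te_mulZr.
Qed.

Lemma pmul0l (a : pres) : pmul 0 a = 0.
Proof. by apply: (addIr (pmul 0 a)); rewrite -pmulDl !add0r. Qed.
Lemma pmul0r (a : pres) : pmul a 0 = 0.
Proof. by apply: (addIr (pmul a 0)); rewrite -pmulDr !add0r. Qed.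

Section Star.
Variable st : X -> X.
Hypothesis stK : involutive st.

Fixpoint tstar (t : tm) : tm :=
  match t with
  | tgen x => tgen (st x)
  | tzero => tzero
  | tadd t u => tadd (tstar t) (tstar u)
  | topp t => topp (tstar t)
  | tscale k t => tscale (rconj l k) (tstar t)
  | tmul t u => tmul (tstar u) (tstar t)
  end.

Hypothesis R_star : forall t u, R t u -> tmeq (tstar t) (tstar u).

Lemma tstarK : involutive tstar.
Proof.
elim=> /= [x||t IHt u IHu|t IHt|k t IHt|t IHt u IHu].
- by rewrite stK.
- by [].
- by rewrite IHt IHu.
- by rewrite IHt.
- by rewrite rconjK IHt.
- by rewrite IHt IHu.
Qed.

Lemma tmeq_star t u : tmeq t u -> tmeq (tstar t) (tstar u).
Proof.
elim=> {t u} /=.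
- exact: R_star.
- by move=> t; apply: te_refl.
- by move=> t u _; apply: te_sym.
- by move=> t u v _ tu _; apply: te_trans.
- by move=> t t' u u' _ tt' _ uu'; apply: te_add.
- by move=> t t' _ tt'; apply: te_opp.
- by move=> k t t' _ tt'; apply: te_scale.
- by move=> t t' u u' _ tt' _ uu'; apply: te_mul.
- by move=> t u v; apply: te_addA.
- by move=> t u; apply: te_addC.
- by move=> t; apply: te_add0.
- by move=> t; apply: te_addN.
- by move=> j k t; rewrite rmorphM; apply: te_scaleA.
- by move=> t; rewrite rmorph1; apply: te_scale1.
- by move=> k t u; apply: te_scaleDr.
- by move=> j k t; rewrite rmorphD; apply: te_scaleDl.
- by move=> t u v; apply/te_sym/te_mulA.
- by move=> t u v; apply: te_mulDr.
- by move=> t u v; apply: te_mulDl.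
- by move=> k t u; apply: te_mulZr.
- by move=> k t u; apply: te_mulZl.
Qed.

Definition pstar (a : pres) : pres := tclass (tstar (trepr a)).

Lemma tclass_star t : tclass (tstar t) = pstar (tclass t).
Proof. by apply/tclassP/tmeq_star/te_sym/trepr_class. Qed.

Fact pstarD : {morph pstar : a b / a + b}.
Proof.
elim/tclass_ind=> a; elim/tclass_ind=> b.
by rewrite -tclassD -!tclass_star -tclassD.
Qed.
Fact pstarM a b : pstar (pmul a b) = pmul (pstar b) (pstar a).
Proof.
elim/tclass_ind: a => a; elim/tclass_ind: b => b.
by rewrite -tclassM -!tclass_star -tclassM.
Qed.
Fact pstarZ (k : l) a : pstar (k *: a) = rconj l k *: pstar a.
Proof.
elim/tclass_ind: a => a.
by rewrite -tclassZ -!tclass_star -tclassZ.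
Qed.
Fact pstarK : involutive pstar.
Proof. by elim/tclass_ind=> a; rewrite -!tclass_star tstarK. Qed.

Section Grading.
Variables (G : groupType) (deg : X -> G).
Hypothesis deg_star : forall x, deg (st x) = (deg x)^-1%g.

Inductive thomog : G -> tm -> Prop :=
| th_gen x : thomog (deg x) (tgen x)
| th_zero g : thomog g tzero
| th_add g t u : thomog g t -> thomog g u -> thomog g (tadd t u)
| th_opp g t : thomog g t -> thomog g (topp t)
| th_scale g k t : thomog g t -> thomog g (tscale k t)
| th_mul g h t u : thomog g t -> thomog h u -> thomog (g * h)%g (tmul t u).

Hypothesis R_homog :
  forall t u, R t u -> exists g, thomog g t /\ thomog g u.

Definition phomog (g : G) (a : pres) : Prop :=
  exists2 t, thomog g t & a = tclass t.

Lemma thomog_star g t : thomog g t -> thomog g^-1%g (tstar t).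
Proof.
elim=> {g t} /=; try by [move=> *; constructor].
- by move=> x; rewrite -deg_star; apply: th_gen.
- by move=> g h t u _ gt _ hu; rewrite invgM; apply: th_mul.
Qed.

Lemma phomog_span a : hspan phomog a.
Proof.
elim/tclass_ind: a; elim=> [x||t IHt u IHu|t IHt|k t IHt|t IHt u IHu].
- by apply: (hspan1 (g := deg x)); exists (tgen x) => //; apply: th_gen.
- exact: hspan0.
- by rewrite tclassD; apply: hspanD.
- rewrite tclassN -scaleN1r.
  apply: (hspan_map _ _ _ IHt); [exact: scalerDr|exact: scaler0|].
  move=> g _ [v gv ->]; apply: (hspan1 (g := g)).
  by exists (tscale (-1) v); [apply: th_scale|rewrite tclassZ].
- rewrite tclassZ; apply: (hspan_map _ _ _ IHt);
    [exact: scalerDr|exact: scaler0|].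
  move=> g _ [v gv ->]; apply: (hspan1 (g := g)).
  by exists (tscale k v); [apply: th_scale|rewrite tclassZ].
rewrite tclassM; move: (tclass t) (tclass u) IHt IHu => a b ha hb.
apply: (hspan_map (f := fun x => pmul x b) _ _ _ ha).
- by move=> x y; rewrite pmulDl.
- exact: pmul0l.
move=> g _ [v gv ->]; apply: (hspan_map (f := pmul (tclass v)) _ _ _ hb).
- by move=> x y; rewrite pmulDr.
- exact: pmul0r.
move=> h _ [w hw ->]; apply: (hspan1 (g := (g * h)%g)).
by exists (tmul v w); [apply: th_mul|rewrite tclassM].
Qed.

(* Left action of the algebra on functions from [G] to its unitization, in
   which elements of degree [g] also translate by [g]; it shows that the
   homogeneous components of an element are unique. *)
Local Notation U := (pres * l^o)%type.

Definition lact (a : pres) (u : U) : U := (pmul a u.1 + (u.2 : l) *: a, 0).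

Lemma lactDr a u v : lact a (u + v) = lact a u + lact a v.
Proof. by congr (_, _); rewrite /= ?addr0 // pmulDr scalerDl addrACA. Qed.
Lemma lactZr a (k : l) u : lact a (k *: u) = k *: lact a u.
Proof. by congr (_, _); rewrite /= ?scaler0 // pmulZr -scalerA scalerDr. Qed.
Lemma lactDl a b u : lact (a + b) u = lact a u + lact b u.
Proof. by congr (_, _); rewrite /= ?addr0 // pmulDl scalerDr addrACA. Qed.
Lemma lactZl (k : l) a u : lact (k *: a) u = k *: lact a u.
Proof.
congr (_, _); rewrite /= ?scaler0 // pmulZl scalerDr; congr (_ + _).
by rewrite !scalerA mulrC.
Qed.
Lemma lactM a b u : lact (pmul a b) u = lact a (lact b u).
Proof. by congr (_, _); rewrite /= pmulDr pmulA pmulZr scale0r addr0. Qed.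
Lemma lact0 a : lact a 0 = 0.
Proof. by apply: (addIr (lact a 0)); rewrite -lactDr !add0r. Qed.
Lemma l0act u : lact 0 u = 0.
Proof. by apply: (addIr (lact 0 u)); rewrite -lactDl !add0r. Qed.

Fixpoint tact (t : tm) (F : G -> U) : G -> U :=
  match t with
  | tgen x => fun h => lact (pgen x) (F ((deg x)^-1 * h)%g)
  | tzero => fun=> 0
  | tadd t u => fun h => tact t F h + tact u F h
  | topp t => fun h => - tact t F h
  | tscale k t => fun h => k *: tact t F h
  | tmul t u => tact t (tact u F)
  end.

Lemma tactD t F F' :
  tact t (fun h => F h + F' h) = (fun h => tact t F h + tact t F' h).
Proof.
elim: t F F' => /= [x||t IHt u IHu|t IHt|k t IHt|t IHt u IHu] F F';
  apply/funext => h.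
- by rewrite lactDr.
- by rewrite addr0.
- by rewrite IHt IHu addrACA.
- by rewrite IHt opprD.
- by rewrite IHt scalerDr.
- by rewrite IHu IHt.
Qed.

Lemma tactZ t (k : l) F :
  tact t (fun h => k *: F h) = (fun h => k *: tact t F h).
Proof.
elim: t F => /= [x||t IHt u IHu|t IHt|j t IHt|t IHt u IHu] F;
  apply/funext => h.
- by rewrite lactZr.
- by rewrite scaler0.
- by rewrite IHt IHu scalerDr.
- by rewrite IHt scalerN.
- by rewrite IHt !scalerA mulrC.
- by rewrite IHu IHt.
Qed.

Lemma thomog_act g t F h :
  thomog g t -> tact t F h = lact (tclass t) (F (g^-1 * h)%g).
Proof.
move=> gt; elim: gt F h => {g t} /= [x|g|g t u _ IHt _ IHu|g t _ IHt|g k t _ IHt|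
    g h t u _ IHt _ IHu] F k'.
- by [].
- by rewrite l0act.
- by rewrite IHt IHu tclassD lactDl.
- by rewrite IHt tclassN -[in RHS]scaleN1r lactZl scaleN1r.
- by rewrite IHt tclassZ lactZl.
- by rewrite IHt IHu tclassM lactM invgM mulgA.
Qed.

Lemma tmeq_act t u : tmeq t u -> tact t = tact u.
Proof.
elim=> {t u} /=.
- move=> t u tu; have [g [gt gu]] := R_homog tu.
  apply/funext => F; apply/funext => h.
  rewrite (thomog_act _ _ gt) (thomog_act _ _ gu).
  by congr (lact _ _); apply/tclassP/te_rel.
- by [].
- by move=> t u _ ->.
- by move=> t u v _ -> _ ->.
- by move=> t t' u u' _ -> _ ->.
- by move=> t t' _ ->.
- by move=> k t t' _ ->.
- by move=> t t' u u' _ -> _ ->.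
- by move=> t u v; apply/funext => F; apply/funext => h; rewrite addrA.
- by move=> t u; apply/funext => F; apply/funext => h; rewrite addrC.
- by move=> t; apply/funext => F; apply/funext => h; rewrite add0r.
- by move=> t; apply/funext => F; apply/funext => h; rewrite addNr.
- by move=> j k t; apply/funext => F; apply/funext => h; rewrite scalerA.
- by move=> t; apply/funext => F; apply/funext => h; rewrite scale1r.
- by move=> k t u; apply/funext => F; apply/funext => h; rewrite scalerDr.
- by move=> j k t; apply/funext => F; apply/funext => h; rewrite scalerDl.
- by [].
- by [].
- by move=> t u v; apply/funext => F; rewrite tactD.
- by [].
- by move=> k t u; apply/funext => F; rewrite tactZ.
Qed.

Lemma phomog_indep (s : seq G) (c : G -> pres) : uniq s ->
  (forall g, phomog g (c g)) -> \sum_(g <- s) c g = 0 ->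
  forall g, g \in s -> c g = 0.
Proof.
move=> us hc c0 g gs.
have [t tP] : exists t : G -> tm, forall g, thomog g (t g) /\ c g = tclass (t g).
  have /choice [t tP] : forall g, exists t, thomog g t /\ c g = tclass t.
    by move=> h; have [t ht ->] := hc h; exists t.
  by exists t.
pose T := foldr (fun g u => tadd (t g) u) tzero s.
have TE : tclass T = \sum_(g <- s) c g.
  rewrite /T; elim: s {us gs c0 T} => [|h s IHs] /=; first by rewrite big_nil.
  by rewrite big_cons -IHs tclassD; case: (tP h) => _ ->.
have TA F h : tact T F h = \sum_(g <- s) lact (c g) (F (g^-1 * h)%g).
  rewrite /T; elim: s {us gs c0 T TE} => [|k s IHs] /=; first by rewrite big_nil.
  rewrite big_cons -IHs; have [kt ->] := tP k.
  by rewrite (thomog_act _ _ kt).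
pose F (h : G) : U := if h == 1%g then (0, 1) else 0.
have : tact T F g = 0.
  by have /tclassP /tmeq_act -> : tclass T = tclass tzero by rewrite TE c0.
rewrite TA (bigD1_seq g) //= big1 ?addr0 => [|h /negPf hg]; last first.
  by rewrite /F mulg_eq1 eqg_inv hg lact0.
rewrite /F mulVg eqxx => /(congr1 fst) /=.
by rewrite scale1r pmul0r add0r.
Qed.

Program Definition gpres : gsalg l G :=
  @GSAlg l G pres pmul pstar phomog pmulA pmulDl pmulDr pmulZl pmulZr
    pstarD pstarM pstarZ pstarK _ _ _ _ _ phomog_span phomog_indep.
Next Obligation. by move=> g; exists tzero => //; apply: th_zero. Qed.
Next Obligation.
move=> g _ _ [t gt ->] [u gu ->].
by exists (tadd t u); [apply: th_add|rewrite tclassD].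
Qed.
Next Obligation.
move=> g k _ [t gt ->].
by exists (tscale k t); [apply: th_scale|rewrite tclassZ].
Qed.
Next Obligation.
move=> g h _ _ [t gt ->] [u hu ->].
by exists (tmul t u); [apply: th_mul|rewrite tclassM].
Qed.
Next Obligation.
move=> g _ [t gt ->].
by exists (tstar t); [apply: thomog_star|rewrite tclass_star].
Qed.

End Grading.
End Star.
End Presentation.

Section Ideal.
Variables (l : inv_ring) (G : groupType) (A : gsalg l G) (S : set A).

Inductive in_ideal : A -> Prop :=
| ideal_in a : S a -> in_ideal a
| ideal_0 : in_ideal 0
| ideal_add a b : in_ideal a -> in_ideal b -> in_ideal (a + b)
| ideal_scale (k : l) a : in_ideal a -> in_ideal (k *: a)
| ideal_mull a b : in_ideal b -> in_ideal (gmul a b)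
| ideal_mulr a b : in_ideal a -> in_ideal (gmul a b).

Definition ideal_pred : {pred A} := fun a => `[< in_ideal a >].

Fact ideal_closed : subsemimod_closed ideal_pred.
Proof.
split; [split|].
- exact/asboolP/ideal_0.
- by move=> a b /asboolP ha /asboolP hb; apply/asboolP/ideal_add.
- by move=> k a /asboolP ha; apply/asboolP/ideal_scale.
Qed.
HB.instance Definition _ := GRing.isSubmodClosed.Build l A ideal_pred ideal_closed.

Record ideal := Ideal { ideal_val : A; _ : ideal_val \in ideal_pred }.
HB.instance Definition _ := [isSub for ideal_val].
HB.instance Definition _ := [Choice of ideal by <:].
HB.instance Definition _ := [SubChoice_isSubLmodule of ideal by <:].

Lemma ideal_valP (a : ideal) : in_ideal (ideal_val a).
Proof. exact/asboolP/(valP a). Qed.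

Definition to_ideal a (ha : in_ideal a) : ideal := @Ideal a (introT (asboolP _) ha).

Lemma ideal_val_inj : injective ideal_val. Proof. exact: val_inj. Qed.
Lemma ideal_valD (a b : ideal) : ideal_val (a + b) = ideal_val a + ideal_val b.
Proof. by []. Qed.
Lemma ideal_valZ (k : l) (a : ideal) : ideal_val (k *: a) = k *: ideal_val a.
Proof. by []. Qed.
Lemma ideal_val0 : ideal_val 0 = 0. Proof. by []. Qed.
Lemma ideal_val_sum (I : Type) (r : seq I) (F : I -> ideal) :
  ideal_val (\sum_(i <- r) F i) = \sum_(i <- r) ideal_val (F i).
Proof. exact: (big_morph ideal_val ideal_valD ideal_val0). Qed.

Definition ideal_mul (a b : ideal) : ideal :=
  to_ideal (ideal_mull (ideal_val a) (ideal_valP b)).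

Definition ideal_homog (g : G) (a : ideal) : Prop := homog g (ideal_val a).

Hypothesis S_homog : forall a, S a -> exists g, homog g a.
Hypothesis S_star : forall a, S a -> S (gstar a).

Lemma in_ideal_star a : in_ideal a -> in_ideal (gstar a).
Proof.
elim=> {a} [a Sa||a b _ ha _ hb|k a _ ha|a b _ hb|a b _ ha].
- exact/ideal_in/S_star.
- by rewrite gstar0; apply: ideal_0.
- by rewrite gstarD; apply: ideal_add.
- by rewrite gstarZ; apply: ideal_scale.
- by rewrite gstarM; apply: ideal_mulr.
- by rewrite gstarM; apply: ideal_mull.
Qed.

Definition ideal_star (a : ideal) : ideal :=
  to_ideal (in_ideal_star (ideal_valP a)).

Lemma ideal_span (a : ideal) : hspan ideal_homog a.
Proof.
pose k (g : G) (b : A) := homog g b /\ in_ideal b.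
suff : hspan k (ideal_val a).
  case=> r rk ra; have [r' er] : exists r' : seq ideal, map ideal_val r' = r.
    elim: r rk {ra} => [|b r IHr] rk; first by exists [::].
    have [|r' er] := IHr; first by move=> c cr; apply: rk; rewrite inE cr orbT.
    have [g [_ hb]] := rk b (mem_head _ _).
    by exists (to_ideal hb :: r'); rewrite /= er.
  exists r'; last by apply: ideal_val_inj; rewrite ideal_val_sum ra -er big_map.
  move=> b br; have [|g [gb _]] := rk (ideal_val b).
    by rewrite -er; apply: map_f.
  by exists g.
elim: (ideal_valP a) => {a} [a Sa||a b _ ha _ hb|j a _ ha|a b _ hb|a b _ ha].
- by have [g ga] := S_homog Sa; apply: (hspan1 (g := g)); split=> //; apply: ideal_in.
- exact: hspan0.
- exact: hspanD.
- apply: (hspan_map _ _ _ ha); [exact: scalerDr|exact: scaler0|].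
  move=> g x [gx hx]; apply: (hspan1 (g := g)).
  by split; [apply: homogZ|apply: ideal_scale].
- apply: (hspan_map (k := @homog _ _ A) (f := fun x => gmul x b) _ _ _ (homog_span a)).
  + by move=> x y; apply: gmulDl.
  + exact: gmul0l.
  move=> g x gx; apply: (hspan_map (f := gmul x) _ _ _ hb).
  + exact: gmulDr.
  + exact: gmul0r.
  move=> h y [hy iy]; apply: (hspan1 (g := (g * h)%g)).
  by split; [apply: homogM|apply: ideal_mull].
- apply: (hspan_map (k := @homog _ _ A) (f := gmul a) _ _ _ (homog_span b)).
  + exact: gmulDr.
  + exact: gmul0r.
  move=> g x gx; apply: (hspan_map (f := fun y => gmul y x) _ _ _ ha).
  + by move=> y z; apply: gmulDl.
  + exact: gmul0l.
  move=> h y [hy iy]; apply: (hspan1 (g := (h * g)%g)).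
  by split; [apply: homogM|apply: ideal_mulr].
Qed.

Program Definition gideal : gsalg l G :=
  @GSAlg l G ideal ideal_mul ideal_star ideal_homog
    _ _ _ _ _ _ _ _ _ _ _ _ _ _ ideal_span _.
Next Obligation. by move=> a b c; apply: ideal_val_inj; apply: gmulA. Qed.
Next Obligation. by move=> a b c; apply: ideal_val_inj; apply: gmulDl. Qed.
Next Obligation. by move=> a b c; apply: ideal_val_inj; apply: gmulDr. Qed.
Next Obligation. by move=> k a b; apply: ideal_val_inj; apply: gmulZl. Qed.
Next Obligation. by move=> k a b; apply: ideal_val_inj; apply: gmulZr. Qed.
Next Obligation. by move=> a b; apply: ideal_val_inj; apply: gstarD. Qed.
Next Obligation. by move=> a b; apply: ideal_val_inj; apply: gstarM. Qed.
Next Obligation. by move=> k a; apply: ideal_val_inj; apply: gstarZ. Qed.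
Next Obligation. by move=> a; apply: ideal_val_inj; apply: gstarK. Qed.
Next Obligation. by move=> g; apply: homog0. Qed.
Next Obligation. by move=> g a b ga gb; apply: homogD. Qed.
Next Obligation. by move=> g k a ga; apply: homogZ. Qed.
Next Obligation. by move=> g h a b ga hb; apply: homogM. Qed.
Next Obligation. by move=> g a ga; apply: homog_star. Qed.
Next Obligation.
move=> s c us hc c0 g gs; apply: ideal_val_inj.
apply: (@homog_indep _ _ _ s (fun g => ideal_val (c g))) => //.
by rewrite -ideal_val_sum c0.
Qed.

End Ideal.

Record graph := Graph {
  vert : choiceType;
  edge : choiceType;
  src : edge -> vert;
  rng : edge -> vert
}.

Definition is_regular (E : graph) (v : vert E) : Prop :=
  finite_set [set e | src e = v] /\ exists e, src e = v.

Definition reg (E : graph) : choiceType := {v : vert E | `[< is_regular v >]}.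

Section Cohn.
Variables (l : inv_ring) (G : groupType) (E : graph) (w : edge E -> G).

Inductive cohn_gen : Type :=
| cgv of vert E
| cge of edge E
| cgs of edge E.

Definition cohn_gen_star (x : cohn_gen) : cohn_gen :=
  match x with cgv v => cgv v | cge e => cgs e | cgs e => cge e end.

Definition cohn_gen_deg (x : cohn_gen) : G :=
  match x with cgv _ => 1 | cge e => w e | cgs e => (w e)^-1 end%g.

Local Notation tv v := (tgen l (cgv v)).
Local Notation te e := (tgen l (cge e)).
Local Notation ts e := (tgen l (cgs e)).

Inductive cohn_rel : tm l cohn_gen -> tm l cohn_gen -> Prop :=
| cr_vv u v : cohn_rel (tmul (tv u) (tv v)) (if u == v then tv u else tzero _ _)
| cr_se e : cohn_rel (tmul (tv (src e)) (te e)) (te e)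
| cr_er e : cohn_rel (tmul (te e) (tv (rng e))) (te e)
| cr_rs e : cohn_rel (tmul (tv (rng e)) (ts e)) (ts e)
| cr_ss e : cohn_rel (tmul (ts e) (tv (src e))) (ts e)
| cr_sf e f :
    cohn_rel (tmul (ts e) (te f)) (if e == f then tv (rng e) else tzero _ _).

Lemma cohn_gen_starK : involutive cohn_gen_star. Proof. by case. Qed.

Lemma cohn_gen_deg_star x : cohn_gen_deg (cohn_gen_star x) = (cohn_gen_deg x)^-1%g.
Proof. by case: x => [v|e|e] //=; rewrite ?invg1 ?invgK. Qed.

Lemma cohn_rel_star t u : cohn_rel t u ->
  tmeq cohn_rel (tstar cohn_gen_star t) (tstar cohn_gen_star u).
Proof.
case=> {t u} /=.
- move=> u v; apply: te_rel; have := cr_vv v u.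
  by rewrite eq_sym; case: eqVneq => [->|].
- by move=> e; apply/te_rel/cr_ss.
- by move=> e; apply/te_rel/cr_rs.
- by move=> e; apply/te_rel/cr_er.
- by move=> e; apply/te_rel/cr_se.
- move=> e f; apply: te_rel; have := cr_sf f e.
  by rewrite eq_sym; case: eqVneq => [->|].
Qed.

Lemma cohn_rel_homog t u : cohn_rel t u ->
  exists g, thomog cohn_gen_deg g t /\ thomog cohn_gen_deg g u.
Proof.
have H x y : thomog cohn_gen_deg (cohn_gen_deg x * cohn_gen_deg y)%g
    (tmul (tgen l x) (tgen l y)) by apply: th_mul; apply: th_gen.
case=> {t u} [u v|e|e|e|e|e f]; (eexists; split; first exact: H) => /=.
- rewrite mulg1; case: eqP => _; last exact: th_zero.
  exact: (th_gen _ _ (cgv u)).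
- by rewrite mul1g; apply: (th_gen _ _ (cge e)).
- by rewrite mulg1; apply: (th_gen _ _ (cge e)).
- by rewrite mul1g; apply: (th_gen _ _ (cgs e)).
- by rewrite mulg1; apply: (th_gen _ _ (cgs e)).
- case: eqP => [->|_]; last exact: th_zero.
  by rewrite mulVg; apply: (th_gen _ _ (cgv (rng f))).
Qed.

Definition cohn : gsalg l G :=
  gpres cohn_gen_starK cohn_rel_star cohn_gen_deg_star cohn_rel_homog.

Definition Cv (v : vert E) : cohn := pgen cohn_rel (cgv v).
Definition Ce (e : edge E) : cohn := pgen cohn_rel (cge e).
Definition Cs (e : edge E) : cohn := pgen cohn_rel (cgs e).

Definition cohn_q (v : vert E) : cohn :=
  Cv v - \sum_(e \in [set e | src e = v]) gmul (Ce e) (Cs e).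

Lemma CvCv u v : gmul (Cv u) (Cv v) = if u == v then Cv u else 0.
Proof.
rewrite /Cv /pgen [LHS](esym (tclassM _ _ _)).
have /te_rel /tclassP -> := cr_vv u v.
by case: eqP.
Qed.
Lemma CvCe e : gmul (Cv (src e)) (Ce e) = Ce e.
Proof. by rewrite [LHS](esym (tclassM _ _ _)); apply/tclassP/te_rel/cr_se. Qed.
Lemma CeCv e : gmul (Ce e) (Cv (rng e)) = Ce e.
Proof. by rewrite [LHS](esym (tclassM _ _ _)); apply/tclassP/te_rel/cr_er. Qed.
Lemma CvCs e : gmul (Cv (rng e)) (Cs e) = Cs e.
Proof. by rewrite [LHS](esym (tclassM _ _ _)); apply/tclassP/te_rel/cr_rs. Qed.
Lemma CsCv e : gmul (Cs e) (Cv (src e)) = Cs e.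
Proof. by rewrite [LHS](esym (tclassM _ _ _)); apply/tclassP/te_rel/cr_ss. Qed.
Lemma CsCe e f : gmul (Cs e) (Ce f) = if e == f then Cv (rng e) else 0.
Proof.
rewrite [LHS](esym (tclassM _ _ _)).
have /te_rel /tclassP -> := cr_sf e f.
by case: eqP.
Qed.

Lemma Cgen_star x : gstar (pgen cohn_rel x : cohn) = pgen cohn_rel (cohn_gen_star x).
Proof. by rewrite /= /pgen -(tclass_star cohn_rel_star). Qed.
Lemma Cgen_homog x : homog (cohn_gen_deg x) (pgen cohn_rel x : cohn).
Proof. by exists (tgen l x) => //; apply: th_gen. Qed.

Lemma gstarN (A : gsalg l G) (a : A) : gstar (- a) = - gstar a.
Proof. by rewrite -scaleN1r gstarZ rmorphN1 scaleN1r. Qed.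
Lemma gmulNl (A : gsalg l G) (a b : A) : gmul (- a) b = - gmul a b.
Proof. by rewrite -scaleN1r gmulZl scaleN1r. Qed.
Lemma gmulNr (A : gsalg l G) (a b : A) : gmul a (- b) = - gmul a b.
Proof. by rewrite -scaleN1r gmulZr scaleN1r. Qed.

Definition out (v : vert E) : seq (edge E) :=
  finite_support 0 [set e | src e = v] (fun e => gmul (Ce e) (Cs e)).

Lemma cohn_qE v : cohn_q v = Cv v - \sum_(e <- out v) gmul (Ce e) (Cs e).
Proof. by []. Qed.

Lemma out_src v e : e \in out v -> src e = v.
Proof.
rewrite /out; case: finite_supportP => // X XE _ _ eX.
exact: XE eX.
Qed.

Lemma cohn_q_star v : gstar (cohn_q v) = cohn_q v.
Proof.
rewrite !cohn_qE gstarD gstarN gstar_sum (Cgen_star (cgv v)); congr (_ - _).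
apply: eq_bigr => e _.
by rewrite gstarM (Cgen_star (cge e)) (Cgen_star (cgs e)).
Qed.

Lemma cohn_q_homog v : homog 1%g (cohn_q v).
Proof.
rewrite cohn_qE; apply: homogD; first exact: (Cgen_homog (cgv v)).
rewrite -scaleN1r; apply: homogZ; apply: homog_sum => e.
rewrite -(mulgV (w e)); apply: homogM; [exact: (Cgen_homog (cge e))|].
exact: (Cgen_homog (cgs e)).
Qed.

Definition cohn_qs : set cohn := [set a | exists2 v, is_regular v & a = cohn_q v].

Fact cohn_qs_homog a : cohn_qs a -> exists g, homog g a.
Proof. by case=> v _ ->; exists 1%g; apply: cohn_q_homog. Qed.
Fact cohn_qs_star a : cohn_qs a -> cohn_qs (gstar a).
Proof. by case=> v hv ->; exists v => //; apply: cohn_q_star. Qed.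

Definition cohn_K : gsalg l G := gideal cohn_qs_homog cohn_qs_star.

Fact cohn_q_in (v : reg E) : in_ideal cohn_qs (cohn_q (val v)).
Proof.
apply: ideal_in; exists (val v) => //.
by have /asboolP := valP v.
Qed.

Definition Kq (v : reg E) : cohn_K := to_ideal (cohn_q_in v).

Lemma CvCe_gen u e : gmul (Cv u) (Ce e) = if u == src e then Ce e else 0.
Proof.
by rewrite -{1}(CvCe e) gmulA CvCv; case: eqVneq => [->|_];
   rewrite ?CvCe ?gmul0l.
Qed.

Lemma CsCv_gen u e : gmul (Cs e) (Cv u) = if u == src e then Cs e else 0.
Proof.
rewrite -{1}(CsCv e) -gmulA CvCv eq_sym; case: eqVneq => [_|_].
  by rewrite CsCv.
by rewrite gmul0r.
Qed.

Lemma out_mem v e : is_regular v -> src e = v ->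
  e \notin out v -> gmul (Ce e) (Cs e) = 0.
Proof.
move=> [vfin _] ev; rewrite /out in_finite_support; last exact: finite_setIl.
move=> /negP nin; apply: contra_notP nin => ne.
by rewrite inE; split.
Qed.

Lemma Cv_q u v : gmul (Cv u) (cohn_q v) = if u == v then cohn_q v else 0.
Proof.
rewrite cohn_qE gmulDr gmulNr gmul_sumr CvCv.
have -> : \sum_(e <- out v) gmul (Cv u) (gmul (Ce e) (Cs e)) =
    if u == v then \sum_(e <- out v) gmul (Ce e) (Cs e) else 0.
  case: eqVneq => [->|uv].
    by apply: eq_big_seq => e /out_src ev; rewrite gmulA -ev CvCe.
  rewrite big1_seq // => e /andP[_ /out_src ev].
  by rewrite gmulA CvCe_gen ev (negPf uv) gmul0l.
by case: eqVneq => [->|_]; rewrite ?subr0.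
Qed.

Lemma Cs_q e v : is_regular v -> gmul (Cs e) (cohn_q v) = 0.
Proof.
move=> rv; rewrite cohn_qE gmulDr gmulNr gmul_sumr CsCv_gen.
have E1 f : gmul (Cs e) (gmul (Ce f) (Cs f)) = if e == f then Cs e else 0.
  rewrite gmulA CsCe; case: eqVneq => [->|_]; first by rewrite CvCs.
  by rewrite gmul0l.
under eq_bigr do rewrite E1.
case: eqVneq => [ve|ve].
  have [eo|eo] := boolP (e \in out v).
    rewrite (bigD1_seq e) //= ?eqxx ?finite_support_uniq // big1 ?addr0 ?subrr //.
    by move=> f fe; rewrite eq_sym (negPf fe).
  rewrite big1_seq => [|f /andP[_ fo]]; last first.
    by case: eqVneq fo eo => [->|] // ->.
  have := out_mem rv (esym ve) eo; move/(congr1 (gmul (Cs e))).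
  by rewrite E1 eqxx gmul0r subr0.
rewrite big1_seq ?subrr // => f /andP[_ /out_src fv].
by case: (eqVneq e f) fv ve => [<-|//] ->; rewrite eqxx.
Qed.

Lemma q_q u v : is_regular v ->
  gmul (cohn_q u) (cohn_q v) = if u == v then cohn_q v else 0.
Proof.
move=> rv; rewrite {1}cohn_qE gmulDl gmulNl gmul_suml Cv_q big1 ?subr0 // => e _.
by rewrite -gmulA Cs_q ?gmul0r.
Qed.

Lemma KqKq u v : gmul (Kq u) (Kq v) = if u == v then Kq v else 0.
Proof.
have rv : is_regular (val v) by have /asboolP := valP v.
apply: ideal_val_inj; apply: etrans (q_q (val u) rv) _.
by rewrite (inj_eq val_inj); case: eqP.
Qed.

Definition q_fun (f : gfun l G (reg E)) : cohn_K :=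
  \sum_(v \in [set: reg E]) (f : ffam _) v *: Kq v.

Lemma q_fun_seq (f : gfun l G (reg E)) (s : seq (reg E)) : uniq s ->
  (forall v, v \notin s -> (f : ffam _) v = 0) ->
  q_fun f = \sum_(v <- s) (f : ffam _) v *: Kq v.
Proof.
move=> us fs; apply: fsum_seq => // v vs.
by rewrite fs // scale0r.
Qed.

Lemma gfun_supp2 (f g : gfun l G (reg E)) : exists s : seq (reg E),
  [/\ uniq s, forall v, v \notin s -> (f : ffam _) v = 0
    & forall v, v \notin s -> (g : ffam _) v = 0].
Proof.
have [s _ fs] := ffam_supp f; have [t _ gt] := ffam_supp g.
exists (undup (s ++ t)); split; first exact: undup_uniq.
- by move=> v; rewrite mem_undup mem_cat negb_or => /andP[/fs].
- by move=> v; rewrite mem_undup mem_cat negb_or => /andP[_ /gt].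
Qed.

Lemma q_linear : linear q_fun.
Proof.
move=> k f g; have [s [us fs gs]] := gfun_supp2 f g.
rewrite (q_fun_seq us fs) (q_fun_seq us gs) (q_fun_seq us); last first.
  by move=> v vs; rewrite ffamDE ffamZE fs // gs // scaler0 addr0.
rewrite scaler_sumr -big_split; apply: eq_bigr => v _ /=.
by rewrite scalerDl scalerA.
Qed.
HB.instance Definition _ :=
  GRing.isLinear.Build l (gfun l G (reg E)) cohn_K _ q_fun q_linear.

Program Definition q_hom : gsmor (gfun l G (reg E)) cohn_K :=
  @GSMor l G (gfun l G (reg E)) cohn_K q_fun _ _ _.
Next Obligation.
move=> f g; have [s [us fs gs]] := gfun_supp2 f g.
rewrite -[LHS]/(q_fun (gmul f g)) -[RHS]/(gmul (q_fun f) (q_fun g)).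
rewrite (q_fun_seq us fs) (q_fun_seq us gs) (q_fun_seq us); last first.
  by move=> v vs; rewrite /= fs // mul0r.
rewrite gmul_suml; apply: eq_big_seq => v vs.
rewrite gmul_sumr (bigD1_seq v) // big1 => [|u uv].
  by rewrite gmulZl gmulZr KqKq eqxx scalerA; apply: esym (addr0 _).
by rewrite gmulZl gmulZr KqKq eq_sym (negPf uv) !scaler0.
Qed.
Next Obligation.
move=> f; have [s [us fs _]] := gfun_supp2 f f.
rewrite -[LHS]/(q_fun (gstar f)) -[RHS]/(gstar (q_fun f)).
rewrite (q_fun_seq us fs) (q_fun_seq us); last first.
  by move=> v vs; rewrite /= fs // rmorph0.
rewrite gstar_sum; apply: eq_bigr => v _; rewrite gstarZ; congr (_ *: _).
by apply: ideal_val_inj; apply: esym (cohn_q_star (val v)).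
Qed.
Next Obligation.
move=> g f gf; apply: homog_sum => v; case: (gf v) => [->|->].
  by apply: homogZ; apply: cohn_q_homog.
by rewrite scale0r; apply: homog0.
Qed.

Lemma q_chi v : q_hom (chi l G v) = Kq v.
Proof.
rewrite /= (@q_fun_seq _ [:: v]) //; first by rewrite big_seq1 /= single_funE scale1r.
by move=> u; rewrite inE => /eqP uv; apply: single_fun0 => vu; apply: uv.
Qed.

End Cohn.

Section Functors.
Variables (l : inv_ring) (G : groupType) (D : additive_category).
Variable F : functor (gscat l G) D.

Definition iota_plus_stable : Prop :=
  forall A : gsalg l G, is_iso (fmor F (corner_pm A : mor (A : gscat l G) _)).

(* [X] is nonempty: for [X] empty the condition makes [F] invert every map
   [0 -> A], hence every morphism. *)
Definition G_stable (E : graph) : Prop :=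
  forall X Y : gset G, inhabited X ->
    card_atmost X (vert E + edge E + nat + G) ->
    card_atmost Y (vert E + edge E + nat + G) ->
  forall A : gsalg l G,
    is_iso (fmor F (mat_incl X Y A : mor (gmat X A : gscat l G) _)).

Definition E_stable (E : graph) : Prop := iota_plus_stable /\ G_stable E.

Definition is_additive (I : Type) : Prop :=
  (forall J : choiceType, card_atmost J I -> forall a : J -> D,
     exists (c : D) (inj : forall j, mor (a j) c), is_coproduct inj) /\
  (forall J : choiceType, card_atmost J I -> forall A : J -> gsalg l G,
     forall (c : D) (inj : forall j, mor (F (A j)) c), is_coproduct inj ->
     forall m : mor c (F (gsum A)),
       (forall j, compm m (inj j) =
          fmor F (gsum_in A j : mor (A j : gscat l G) (gsum A))) ->
     is_iso m).

End Functors.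

(* Main.v *)
From HB Require Import structures.
From mathcomp Require Import all_boot all_order all_algebra.
From mathcomp Require Import all_classical.
Require Import Defs.
Set Implicit Arguments.
Unset Strict Implicit.
Unset Printing Implicit Defensive.
Import GRing.Theory.
Local Open Scope classical_set_scope.
Local Open Scope ring_scope.

(** The ideal [K(E)] is a direct sum of matrix algebras, and [q] is the direct
    sum of the corner inclusions into its summands.

    For a regular vertex [v] let [P_v] be the set of finite paths which end at
    [v], a path being graded by its weight. The relations of the Cohn algebra
    give [e^* q_v = 0 = q_v e], so that
    [(a q_v)^* (b q_u) = delta_(a,b) delta_(u,v) q_v] for paths [a] and [b]
    which end at [u] and [v] ([path_q_orth]). Hence the elements [a q_v b^*],
    for [a] and [b] in [P_v], multiply like matrix units, those of different
    vertices being orthogonal, and the assignment of [a q_v b^*] to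
    [epsilon_(a,b)] is a graded *-homomorphism from the direct sum over [v] of
    the [M_(P_v) l] to [K(E)] ([matrices_to_K_mor]).

    It is onto because the span of the [a q_v b^*] is stable under
    multiplication by the generators of the Cohn algebra ([in_image_gen]), hence
    is a two-sided ideal which contains the [q_v]. It is one to one because
    multiplying by [(a q_v)^*] on the left and by [b q_v] on the right isolates
    the coefficient of [a q_v b^*] as a multiple of [q_v], and [q_v] generates a
    free module ([cohn_q_free]): in the representation of the Cohn algebra on
    functions of paths, [q_v] fixes the indicator function of the trivial path
    at [v]. A bijective graded *-homomorphism is an isomorphism
    ([bijective_is_iso]).

    Under this isomorphism [q] sends [chi_v] to the matrix unit at the trivial
    path, so on the [v]-th summand it is the corner inclusion of [l] in
    [M_(P_v) l], which is a composite of [l = M_1 l] with the inclusion of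
    [M_1 l] in [M_(1 + Y) l] for the set [Y] of nontrivial paths. [F] inverts it
    by [G]-stability, provided that [Y] is small enough; this is the fact of
    cardinal arithmetic that the finite words in an infinite alphabet are no
    more numerous than its letters ([words_card]). Since [F] is additive it
    then inverts the direct sum of the corner inclusions too
    ([additive_iso]). *)

(** * Isomorphisms, coproducts and additive functors *)

Section Isomorphisms.
Variable C : category.

Lemma is_iso_comp (x y z : C) (g : mor y z) (f : mor x y) :
  is_iso g -> is_iso f -> is_iso (compm g f).
Proof.
move=> [g' [g'g gg']] [f' [f'f ff']]; exists (compm f' g'); split.
  by rewrite compmA -(compmA f' g' g) g'g compm1.
by rewrite compmA -(compmA g f f') ff' compm1.
Qed.

Lemma is_iso_cancelr (x y z : C) (g : mor y z) (f : mor x y) :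
  is_iso f -> is_iso (compm g f) -> is_iso g.
Proof.
move=> [f' [f'f ff']] gf_iso.
have -> : g = compm (compm g f) f' by rewrite -compmA ff' compm1.
by apply: is_iso_comp => //; exists f.
Qed.

Lemma is_iso_cancell (x y z : C) (g : mor y z) (f : mor x y) :
  is_iso g -> is_iso (compm g f) -> is_iso f.
Proof.
move=> [g' [g'g gg']] gf_iso.
have -> : f = compm g' (compm g f) by rewrite compmA g'g comp1m.
by apply: is_iso_comp => //; exists g.
Qed.

(** A coproduct can be transported along isomorphisms of its summands. It is
    stated so that the coproduct which is already known has the summands [a]:
    no inverse of [k] then has to be named. *)
Lemma is_coproduct_iso (J : Type) (a b : J -> C) (c : C)
    (inj : forall j, mor (b j) c) (k : forall j, mor (a j) (b j)) :
  (forall j, is_iso (k j)) -> is_coproduct (fun j => compm (inj j) (k j)) ->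
  is_coproduct inj.
Proof.
move=> kiso cop x f.
have [h [hP hU]] := cop x (fun j => compm (f j) (k j)).
exists h; split=> [j|h' h'P].
  have [k' [_ kk']] := kiso j.
  have := congr1 (fun m => compm m k') (hP j).
  by rewrite -!compmA kk' !compm1.
by apply: hU => j; rewrite compmA h'P.
Qed.

End Isomorphisms.

Lemma functor_iso (C D : category) (F : functor C D) (x y : C) (f : mor x y) :
  is_iso f -> is_iso (fmor F f).
Proof.
by move=> [g [gf fg]]; exists (fmor F g); rewrite -!fmorM gf fg !fmor1.
Qed.

(** One object [c] serves as the coproduct both of the [F (A j)] and, through
    the [F (k j)], of the [F (B j)]. The two comparison maps out of [c] are
    isomorphisms by additivity, and [F Phi] carries the first to the second. *)
Lemma additive_iso (l : inv_ring) (G : groupType) (D : additive_category)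
    (F : functor (gscat l G) D) (J : choiceType) (A B : J -> gsalg l G)
    (k : forall j, gsmor (A j) (B j)) (Phi : gsmor (gsum A) (gsum B)) :
  is_additive F J ->
  (forall j, is_iso (fmor F (k j : mor (A j : gscat l G) (B j)))) ->
  (forall j, gscomp Phi (gsum_in A j) = gscomp (gsum_in B j) (k j)) ->
  is_iso (fmor F (Phi : mor (gsum A : gscat l G) (gsum B))).
Proof.
move=> [Fex Fiso] kiso PhiE; have leJ : card_atmost J J by exists id.
pose Fk j := fmor F (k j : mor (A j : gscat l G) (B j)).
have [c [injA copA]] := Fex J leJ (fun j => F (A j)).
have ex_injB j : exists i, compm i (Fk j) = injA j.
  have [k' [k'k _]] := kiso j; exists (compm (injA j) k').
  by rewrite -compmA k'k compm1.
pose injB j := projT1 (cid (ex_injB j)).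
have injBk j : compm (injB j) (Fk j) = injA j := projT2 (cid (ex_injB j)).
have copB : is_coproduct injB.
  apply: (is_coproduct_iso (k := Fk)) => //.
  by have -> : (fun j => compm (injB j) (Fk j)) = injA
    by exact: functional_extensionality_dep.
have [mA [mAP _]] :=
  copA _ (fun j => fmor F (gsum_in A j : mor (A j : gscat l G) (gsum A))).
have [mB [mBP _]] :=
  copB _ (fun j => fmor F (gsum_in B j : mor (B j : gscat l G) (gsum B))).
have mA_iso : is_iso mA by apply: Fiso copA _ mAP.
apply: (is_iso_cancelr mA_iso).
suff -> : compm (fmor F (Phi : mor (gsum A : gscat l G) (gsum B))) mA = mB.
  by apply: Fiso copB _ mBP.
have [h [_ hU]] := copA _ (fun j => compm mB (injA j)).
rewrite -(hU mB) //; apply/esym/hU => j.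
rewrite -compmA mAP -fmorM [compm _ _]PhiE -injBk compmA mBP.
exact: (@fmorM _ _ F (A j : gscat l G) (B j : gscat l G) (gsum B : gscat l G)).
Qed.

(** * Bijective graded *-homomorphisms *)

Section HomogeneousComponents.
Variables (l : inv_ring) (G : groupType) (A : gsalg l G).

Lemma homog_decomp (a : A) : exists (s : seq G) (c : G -> A),
  [/\ uniq s, forall g, homog g (c g) & a = \sum_(g <- s) c g].
Proof.
have [r rh ->] := homog_span a.
elim: r rh => [|b r IHr] rh; first by exists [::], (fun=> 0); split=> [|g|];
  [|exact: homog0|rewrite !big_nil].
have [|s [c [us ch e]]] := IHr; first by move=> x xr; apply: rh; rewrite inE xr orbT.
have [g bg] := rh b (mem_head _ _).
exists (undup (g :: s)), (fun h => (if h == g then b else 0) +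
  (if h \in s then c h else 0)); split; first exact: undup_uniq.
  move=> h; apply: homogD; first by case: eqP => [->|_]; [|exact: homog0].
  by case: ifP => _; [apply: ch|apply: homog0].
have gU : g \in undup (g :: s) by rewrite mem_undup mem_head.
rewrite big_cons e big_split; congr (_ + _).
  rewrite (bigD1_seq g) ?undup_uniq //= eqxx big1 ?addr0 // => h /negPf ->.
  by [].
rewrite -big_mkcond -big_filter; apply: perm_big; apply: uniq_perm => //.
  by rewrite filter_uniq ?undup_uniq.
by move=> h; rewrite mem_filter mem_undup inE; case: (h \in s) => //=; rewrite orbT.
Qed.

(** Subtracting [a] from its component of degree [g] leaves a family of
    homogeneous elements of sum zero. *)
Lemma homog_component (g : G) (a : A) (s : seq G) (c : G -> A) :
  homog g a -> uniq s -> (forall h, homog h (c h)) -> a = \sum_(h <- s) c h ->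
  forall h, h \in s -> h != g -> c h = 0.
Proof.
move=> ga us ch e h hs hg.
pose c' x := if x == g then c x - a else c x.
have [gs|gs] := boolP (g \in s); last first.
  have := @homog_indep _ _ _ (g :: s) (fun x => if x == g then - a else c x).
  move=> /(_ _ _ _ h); rewrite (negPf hg) inE hs orbT; apply=> //=.
  - by rewrite gs.
  - move=> x; case: eqP => [->|_ //].
    by rewrite -scaleN1r; apply: homogZ.
  rewrite big_cons eqxx; apply/eqP; rewrite addrC subr_eq0; apply/eqP.
  rewrite [RHS]e; apply: eq_big_seq => x xs; case: eqP => // xg.
  by rewrite -xg xs in gs.
have := @homog_indep _ _ _ s c' us; move=> /(_ _ _ h hs).
rewrite /c' (negPf hg); apply.
  move=> x; case: eqP => [->|_ //]; apply: homogD => //.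
  by rewrite -scaleN1r; apply: homogZ.
rewrite (bigD1_seq g) //= eqxx addrAC e (bigD1_seq g) //=.
rewrite [X in _ + X - _](eq_bigr c) ?subrr // => x /negPf ->.
by [].
Qed.

End HomogeneousComponents.

Section BijectiveMorphism.
Variables (l : inv_ring) (G : groupType) (A B : gsalg l G) (f : gsmor A B).
Hypothesis f_inj : forall a, f a = 0 -> a = 0.
Hypothesis f_surj : forall b, exists a, f a = b.

Definition gsinv_fun (b : B) : A := projT1 (cid (f_surj b)).

Lemma gsinv_funK : cancel gsinv_fun f.
Proof. by move=> b; apply: (projT2 (cid (f_surj b))). Qed.

Lemma gsmor_inj : injective f.
Proof.
by move=> a b e; apply/eqP; rewrite -subr_eq0; apply/eqP/f_inj;
   rewrite linearB e subrr.
Qed.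

Lemma gsinv_linear : linear gsinv_fun.
Proof. by move=> k a b; apply: gsmor_inj; rewrite linearP !gsinv_funK. Qed.

HB.instance Definition _ := GRing.isLinear.Build l B A _ gsinv_fun gsinv_linear.

(** The image under [f] of a component of degree other than [g] is a component
    of the homogeneous element [b], hence vanishes. *)
Lemma gsinv_homog g b : homog g b -> homog g (gsinv_fun b).
Proof.
move=> gb; have [s [c [us ch e]]] := homog_decomp (gsinv_fun b).
have c0 h : h \in s -> h != g -> c h = 0.
  move=> hs hg; apply: f_inj.
  apply: (homog_component gb us (fun h => gsmor_homog f (ch h))) hs hg.
  by rewrite -[LHS]gsinv_funK e linear_sum.
rewrite e; have [gs|gs] := boolP (g \in s).
  rewrite (bigD1_seq g) //= big_seq_cond big1 ?addr0 // => h /andP[].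
  exact: c0.
rewrite big_seq big1 => [|h hs]; first exact: homog0.
by apply: c0 => //; apply: contraNneq gs => <-.
Qed.

Lemma gsinv_mul a b : gsinv_fun (gmul a b) = gmul (gsinv_fun a) (gsinv_fun b).
Proof. by apply: gsmor_inj; rewrite gsmorM !gsinv_funK. Qed.

Lemma gsinv_star a : gsinv_fun (gstar a) = gstar (gsinv_fun a).
Proof. by apply: gsmor_inj; rewrite gsmor_star !gsinv_funK. Qed.

Lemma bijective_is_iso : is_iso (f : mor (A : gscat l G) B).
Proof.
exists (GSMor gsinv_mul gsinv_star gsinv_homog); split; apply: gsmor_ext => a /=.
  by apply: gsmor_inj; rewrite gsinv_funK.
exact: gsinv_funK.
Qed.

End BijectiveMorphism.

(** * Words in an infinite alphabet *)

Definition inj_into (T U : Type) (A : set T) (B : set U) (f : T -> U) : Prop :=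
  (forall x, A x -> B (f x)) /\
  (forall x y, A x -> A y -> f x = f y -> x = y).

Lemma choice_on (T U : Type) (u0 : T -> U) (A : set T) (R : T -> U -> Prop) :
  (forall x, A x -> exists y, R x y) ->
  exists f : T -> U, forall x, A x -> R x (f x).
Proof.
move=> AR; have /choice [f fP] : forall x, exists y, A x -> R x y.
  move=> x; have [/AR [y xy]|nA] := pselect (A x); first by exists y.
  by exists (u0 x).
by exists f.
Qed.

(** Comparability of cardinals: a maximal partial injection between [A] and [B]
    is defined on all of [A] or onto [B], since otherwise one more pair fits. *)
Lemma inj_into_total (T : Type) (A B : set T) :
  (exists f, inj_into A B f) \/ (exists f, inj_into B A f).
Proof.
pose P (R : set (T * T)) := [/\ forall x y, R (x, y) -> A x /\ B y,
  forall x y y', R (x, y) -> R (x, y') -> y = y' &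
  forall x x' y, R (x, y) -> R (x', y) -> x = x'].
have [|R [[RAB Rf Ri] Rmax]] := @Zorn_bigcup _ P.
  move=> F FP Ftot.
  have common p q : (\bigcup_(X in F) X) p -> (\bigcup_(X in F) X) q ->
      exists2 X, F X & X p /\ X q.
    move=> [X FX Xp] [Y FY Yq]; have [XY|YX] := Ftot X Y FX FY.
      by exists Y => //; split=> //; apply: XY.
    by exists X => //; split=> //; apply: YX.
  split=> [x y [X FX Xxy]|x y y' h h'|x x' y h h'].
  - by have [+ _ _] := FP X FX; apply.
  - have [X FX [Xy Xy']] := common _ _ h h'; have [_ Xf _] := FP X FX.
    exact: Xf Xy Xy'.
  have [X FX [Xy Xy']] := common _ _ h h'; have [_ _ Xi] := FP X FX.
  exact: Xi Xy Xy'.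
have [Rtot|/existsNP[x0 /not_implyP[Ax0 nx0]]] :=
    pselect (forall x, A x -> exists y, R (x, y)).
  left; have [f fP] := choice_on id Rtot; exists f; split.
    by move=> x /fP /RAB [].
  by move=> x y /fP + /fP; move=> + + e; rewrite e; apply: Ri.
have [Rsurj|/existsNP[y0 /not_implyP[By0 ny0]]] :=
    pselect (forall y, B y -> exists x, R (x, y)).
  right; have [f fP] := choice_on id Rsurj; exists f; split.
    by move=> x /fP /RAB [].
  by move=> x y /fP + /fP; move=> + + e; rewrite e; apply: Rf.
exfalso; apply: (Rmax (R `|` [set (x0, y0)])).
  split; first by move=> p; left.
  by move=> /(_ (x0, y0)); move=> h; apply: nx0; exists y0; apply: h; right.
split=> [x y [/RAB //|[-> ->]] //|x y y' [h|[ex ey]] [h'|[ex' ey']]|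
         x x' y [h|[ex ey]] [h'|[ex' ey']]].
- exact: Rf h h'.
- by case: nx0; exists y; rewrite -ex'.
- by case: nx0; exists y'; rewrite -ex.
- by rewrite ey ey'.
- exact: Ri h h'.
- by case: ny0; exists x; rewrite -ey'.
- by case: ny0; exists x'; rewrite -ey.
- by rewrite ex ex'.
Qed.

Section Words.
Variable T : choiceType.
Implicit Types (A B : set T) (s : seq T).

(** The empty word is left out so that the empty relation is a [word_code], which
    the union of the empty chain requires. *)
Definition words A : set (seq T) := [set s | s <> [::] /\ forall a, a \in s -> A a].

Definition letters (R : set (seq T * T)) : set T := [set a | exists t, R ([:: a], t)].

(** The graphs of the injections of the words over some alphabet into that same
    alphabet; the alphabet is read off from the words of length one in the
    domain. Graphs, unlike functions, can be united along a chain. *)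
Definition word_code (R : set (seq T * T)) : Prop :=
  [/\ forall s t, R (s, t) -> words (letters R) s /\ letters R t,
      forall s, words (letters R) s -> exists t, R (s, t),
      forall s t t', R (s, t) -> R (s, t') -> t = t' &
      forall s s' t, R (s, t) -> R (s', t) -> s = s'].

Lemma words1 A a : A a -> words A [:: a].
Proof. by move=> Aa; split=> // x; rewrite inE => /eqP ->. Qed.

Lemma letters_mono (R S : set (seq T * T)) : R `<=` S -> letters R `<=` letters S.
Proof. by move=> RS a [t /RS h]; exists t. Qed.

Lemma words_mono A B : A `<=` B -> words A `<=` words B.
Proof. by move=> AB s [s0 sA]; split=> // a /sA /AB. Qed.

Lemma word_code_chain (F : set (set (seq T * T))) :
  F `<=` word_code -> total_on F subset -> word_code (\bigcup_(X in F) X).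
Proof.
move=> FP Ftot; set U := \bigcup_(X in F) X.
have up X Y : F X -> F Y -> exists2 Z, F Z & X `<=` Z /\ Y `<=` Z.
  move=> FX FY; have [XY|YX] := Ftot X Y FX FY; [exists Y|exists X] => //.
    by split=> // ? ?.
  by split=> // ? ?.
have XU X : F X -> X `<=` U by move=> FX p Xp; exists X.
split=> [s t [X FX Xst]|s [s0 sU]|s t t' [X FX h] [Y FY h']|s s' t [X FX h] [Y FY h']].
- have [XA _ _ _] := FP X FX; have [sX tX] := XA s t Xst.
  by split; [apply: words_mono (letters_mono (XU X FX)) _ sX
            |apply: letters_mono (XU X FX) _ tX].
- (* the finitely many letters of a word all occur in one member of the chain *)
  have [X FX sX] : exists2 X, F X & forall a, a \in s -> letters X a.
    elim: s s0 sU => // a s IHs _ asU.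
    have [t [X FX Xat]] := asU a (mem_head a s).
    have [s0|/eqP s0] := eqVneq s [::].
      by exists X => // b; rewrite s0 inE => /eqP ->; exists t.
    have [|Y FY sY] := IHs s0; first by move=> b bs; apply: asU; rewrite inE bs orbT.
    have [Z FZ [XZ YZ]] := up X Y FX FY; exists Z => // b; rewrite inE.
    case/orP=> [/eqP ->|/sY]; last exact: letters_mono.
    by exists t; apply: XZ.
  have [_ Xtot _ _] := FP X FX; have [//|t Xst] := Xtot s.
  by exists t, X.
- have [Z FZ [XZ YZ]] := up X Y FX FY; have [_ _ Zf _] := FP Z FZ.
  exact: Zf (XZ _ h) (YZ _ h').
- have [Z FZ [XZ YZ]] := up X Y FX FY; have [_ _ _ Zi] := FP Z FZ.
  exact: Zi (XZ _ h) (YZ _ h').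
Qed.

(** New words, those with a letter outside the old alphabet, are sent to new
    letters, so that they cannot collide with old ones. *)
Lemma word_code_extend (R : set (seq T * T)) B (h : seq T -> T) :
  word_code R -> (forall b, B b -> ~ letters R b) -> B !=set0 ->
  inj_into (words (letters R `|` B)) B h ->
  exists2 S, word_code S & R `<` S.
Proof.
move=> [RA Rtot Rf Ri] BA [b0 Bb0] [hB hi]; set A := letters R.
pose S := R `|` [set p | [/\ words (A `|` B) p.1, ~ words A p.1 & p.2 = h p.1]].
have SA : letters S = A `|` B.
  apply/seteqP; split=> [a [t [Rat|[/= [_ aAB] _ _]]]|a [[t Rat]|Ba]].
  - by left; exists t.
  - by apply: aAB; rewrite inE.
  - by exists t; left.
  - exists (h [:: a]); right; split=> //=; first by apply: words1; right.
    by case=> _ /(_ a (mem_head _ _)) /(BA a Ba).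
have hS s t : words (A `|` B) s -> t = h s -> B t by move=> sAB ->; apply: hB.
exists S; last first.
  split; first by move=> p; left.
  move=> /(_ ([:: b0], h [:: b0])) SR; apply: (BA b0 Bb0); exists (h [:: b0]).
  apply: SR; right; split=> //=; first by apply: words1; right.
  by case=> _ /(_ b0 (mem_head _ _)) /(BA b0 Bb0).
split; rewrite ?SA.
- move=> s t [/RA [sA tA]|[/= sAB _ e]].
    by split; [apply: words_mono sA|]; left.
  by split=> //; right; apply: hS sAB e.
- move=> s sAB; have [/Rtot [t st]|nA] := pselect (words A s).
    by exists t; left.
  by exists (h s); right.
- move=> s t t' [st|[/= sAB nA ->]] [st'|[/= _ nA' ->]] //; first exact: Rf st st'.
  + by have [/nA'] := RA _ _ st.
  + by have [/nA] := RA _ _ st'.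
- move=> s s' t [st|[/= sAB nA e]] [st'|[/= sAB' nA' e']].
  + exact: Ri st st'.
  + by have [_ tA] := RA _ _ st; case: (BA t (hS _ _ sAB' e')).
  + by have [_ tA] := RA _ _ st'; case: (BA t (hS _ _ sAB e)).
  + by apply: hi => //; rewrite -e -e'.
Qed.

(** A letter [x] of [A] is coded by the word [x], and a letter [x] of [B] outside
    [A] by [i x] written twice: the length of the word tells the cases apart. *)
Lemma absorb A B (f : seq T -> T) (i : T -> T) :
  inj_into (words A) A f -> inj_into (B `\` A) A i ->
  exists g, inj_into (A `|` B) A g.
Proof.
move=> [fA fi] [iA ii].
pose c x := if pselect (A x) then [:: x] else [:: i x; i x].
have cA x : (A `|` B) x -> words A (c x).
  rewrite /c => ABx; case: pselect => Ax; first exact: words1.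
  case: ABx => // Bx; split=> // y; rewrite !inE orbb => /eqP ->.
  exact: iA.
exists (f \o c); split=> [x ABx|x y ABx ABy /(fi _ _ (cA x ABx) (cA y ABy))].
  exact/fA/cA.
rewrite /c; case: pselect => Ax; case: pselect => Ay //= [] // e _.
by apply: ii => //; [case: ABx|case: ABy].
Qed.

(** Let [A] be the alphabet of a maximal code. If [A] were no larger than its
    complement, a copy of [A] in the complement could be added to it. So the
    complement injects into [A], whence the whole type does, and the code of [A]
    serves for all words. *)
Theorem words_card : card_atmost nat T -> card_atmost (seq T) T.
Proof.
move=> [k ki].
have [|R [Rcode Rmax]] := @Zorn_bigcup _ word_code; first exact: word_code_chain.
have nomore S : word_code S -> R `<` S -> False by move=> h /Rmax.
set A := letters R.
have [[a0 Aa0]|nA] := pselect (A !=set0); last first.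
  (* a code over the empty alphabet extends by a countable alphabet *)
  exfalso; pose B := range k.
  pose h s := k (pickle (map (fun t => xget 0 [set n | k n = t]) s)).
  have [|||S] := @word_code_extend R B h Rcode.
  - by move=> b _ Ab; apply: nA; exists b.
  - by exists (k 0); exists 0.
  - have kK t : (A `|` B) t -> k (xget 0 [set n | k n = t]) = t.
      move=> [At|[n _ nt]]; first by case: nA; exists t.
      by case: xgetP => [m _ -> //|/(_ n)].
    split=> [s _|s s' [_ sAB] [_ sAB']]; first by eexists.
    move=> /ki /(pcan_inj (@pickleK (seq nat))) e.
    have H u : (forall a, a \in u -> (A `|` B) a) ->
        map k (map (fun t => xget 0 [set n | k n = t]) u) = u.
      by move=> uAB; rewrite -map_comp; apply: map_id_in => a /uAB /kK.
    by rewrite -(H s) // -(H s') // e.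
  - exact: nomore.
have [RA Rtot Rf Ri] := Rcode.
have [f fR] := choice_on (head a0) Rtot.
have finj : inj_into (words A) A f.
  split=> [s /fR /RA [] //|s s' /fR + /fR + e].
  by rewrite e; apply: Ri.
have [[j [jA ji]]|[i iinj]] := inj_into_total A (~` A).
  (* the complement is at least as large as [A] *)
  exfalso; pose B := j @` A.
  have /choice_on : forall b, (B `\` A) b -> exists a, A a /\ j a = b.
    by move=> b [[a Aa <-] _]; exists a.
  move=> /(_ id) [i iP].
  have [] := @absorb A B f i finj.
    split=> [b /iP [] //|b b' /iP[_ e] /iP[_ e'] eq].
    by rewrite -e -e' eq.
  move=> g [gA gi].
  have [|||S] := @word_code_extend R B (j \o f \o map g) Rcode.
  - by move=> _ [a Aa <-]; apply: jA.
  - by exists (j a0); exists a0.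
  - have gW s : words (A `|` B) s -> words A (map g s).
      move=> [s0 sAB]; split; first by case: s s0 sAB.
      by move=> _ /mapP [a /sAB /gA ? ->].
    split=> [s /gW sA|s s' sW sW' /=].
      by exists (f (map g s)) => //; apply: finj.1.
    move=> /(ji _ _ (finj.1 _ (gW _ sW)) (finj.1 _ (gW _ sW'))).
    move=> /(finj.2 _ _ (gW _ sW) (gW _ sW')).
    case: sW sW' => _ sAB [_ sAB'].
    elim: s s' sAB sAB' => [|x s IHs] [|y s'] //= sAB sAB' [].
    have mem z u (H : forall a, a \in z :: u -> (A `|` B) a) :
      (A `|` B) z /\ forall a, a \in u -> (A `|` B) a.
      by split=> [|a au]; apply: H; rewrite inE ?eqxx ?au ?orbT.
    have [xA sA] := mem _ _ sAB; have [yA sA'] := mem _ _ sAB'.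
    by move=> /(gi _ _ xA yA) -> /(IHs _ sA sA') ->.
  - exact: nomore.
have [|g [gA gi]] := @absorb A setT f i finj; first by rewrite setTD.
have ginj : injective g by move=> x y; apply: gi; right.
(* the leading letter makes the code of the empty word a nonempty word *)
exists (fun s => f (a0 :: map g s)) => s s'.
have W u : words A (a0 :: map g u).
  split=> // a; rewrite inE => /orP[/eqP -> //|/mapP [b _ ->]].
  by apply: gA; right.
by move=> /(finj.2 _ _ (W s) (W s')) [] /(inj_map ginj).
Qed.

End Words.

(** * Direct sums, matrix units and corners *)

Section FiniteFamilies.
Variables (l : inv_ring) (J : choiceType) (M : J -> lmodType l).

Lemma ffam_ind (P : ffam M -> Prop) :
  P 0 -> (forall f g, P f -> P g -> P (f + g)) ->
  (forall j (x : M j), P (single x)) -> forall f, P f.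
Proof.
move=> P0 PD P1 f; have [s us fs] := ffam_supp f; rewrite (ffam_decomp us fs).
by elim/big_rec: _ => // j x _; apply: PD.
Qed.

Variables (V : lmodType l) (F : forall j, {linear M j -> V}).

Definition ffam_lift (f : ffam M) : V := \sum_(j \in [set: J]) F j (f j).

Lemma ffam_lift_seq (f : ffam M) (s : seq J) : uniq s ->
  (forall j, j \notin s -> f j = 0) -> ffam_lift f = \sum_(j <- s) F j (f j).
Proof. by move=> us fs; apply: fsum_seq => // j /fs ->; rewrite linear0. Qed.

Lemma ffam_lift_linear : linear ffam_lift.
Proof.
move=> k f g; have [s _ fs] := ffam_supp f; have [t _ gt] := ffam_supp g.
pose u := undup (s ++ t).
have fu j : j \notin u -> f j = 0.
  by rewrite mem_undup mem_cat negb_or => /andP[/fs].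
have gu j : j \notin u -> g j = 0.
  by rewrite mem_undup mem_cat negb_or => /andP[_ /gt].
rewrite !(@ffam_lift_seq _ u) ?undup_uniq //; last first.
  by move=> j ju; rewrite ffamDE ffamZE fu // gu // scaler0 addr0.
rewrite scaler_sumr -big_split; apply: eq_bigr => j _.
exact: linearP.
Qed.
HB.instance Definition _ :=
  GRing.isLinear.Build l (ffam M) V _ ffam_lift ffam_lift_linear.

Lemma ffam_lift_single j (x : M j) : ffam_lift (single x) = F j x.
Proof.
rewrite (@ffam_lift_seq _ [:: j]) ?big_seq1 /= ?single_funE // => i.
by rewrite inE => /eqP ij; apply: single_fun0 => ji; apply: ij.
Qed.

End FiniteFamilies.

Lemma gsum_in_orth (l : inv_ring) (G : groupType) (J : choiceType)
    (A : J -> gsalg l G) i j (a : A i) (b : A j) : i != j ->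
  gmul (gsum_in A i a) (gsum_in A j b) = 0.
Proof.
move=> /eqP ij; apply: ffam_ext => k.
rewrite -[LHS]/(gmul (single_fun a k) (single_fun b k)).
have [ik|ik] := pselect (i = k); last by rewrite (single_fun0 a ik) gmul0l.
by rewrite (@single_fun0 _ _ _ _ b) ?gmul0r // => jk; apply: ij; rewrite ik jk.
Qed.

Section MatrixUnits.
Variables (l : inv_ring) (G : groupType) (X : gset G) (A : gsalg l G).

Definition munit (x y : X) (a : A) : gmat X A :=
  @single l (X * X)%type (fun=> A : lmodType l) (x, y) a.

Lemma munitE x y a x' y' :
  (munit x y a : ffam _) (x', y') = if (x == x') && (y == y') then a else 0.
Proof.
case: eqVneq => [<-|/eqP xx'] /=; last by apply: single_fun0 => -[].
case: eqVneq => [<-|/eqP yy'] /=; last by apply: single_fun0 => -[].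
exact: single_funE.
Qed.

Lemma munitM x y y' z a b :
  gmul (munit x y a) (munit y' z b) = if y == y' then munit x z (gmul a b) else 0.
Proof.
apply: ffam_ext => -[p q]; rewrite [LHS](@fsum_seq _ _ _ [:: y]) //= => [|t]; last first.
  rewrite inE eq_sym => yt; rewrite [X in gmul X _]munitE (negPf yt) andbF.
  exact: gmul0l.
rewrite big_seq1 [X in gmul X _]munitE [X in gmul _ X]munitE eqxx andbT.
rewrite (eq_sym y' y); case: (eqVneq y y') => [_|yy'] /=; last by rewrite gmul0r.
by rewrite [RHS]munitE; case: (x == p); case: (z == q); rewrite ?gmul0l ?gmul0r.
Qed.

Lemma munit_star x y a : gstar (munit x y a) = munit y x (gstar a).
Proof.
apply: ffam_ext => -[p q]; rewrite [RHS]munitE.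
rewrite -[LHS]/(gstar ((munit x y a : ffam _) (q, p))) munitE andbC.
by case: ifP => // _; apply: gstar0.
Qed.

Lemma munit_linear x y : linear (munit x y). Proof. exact: single_linear. Qed.

End MatrixUnits.

Section Corner.
Variables (l : inv_ring) (G : groupType).

Definition gset_unit : gset G := @GSet G unit (fun=> 1%g).

Section One.
Variable A : gsalg l G.

HB.instance Definition _ := GRing.isLinear.Build l A (gmat gset_unit A) _
  (@munit l G gset_unit A tt tt) (@munit_linear l G gset_unit A tt tt).

Lemma scalar_mx_homog g (a : A) : homog g a ->
  homog g (@munit l G gset_unit A tt tt a).
Proof. by move=> ga [] []; rewrite munitE /= invg1 mul1g mulg1. Qed.

Definition scalar_mx : gsmor A (gmat gset_unit A) :=
  @GSMor l G A (gmat gset_unit A) (@munit l G gset_unit A tt tt)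
    (fun a b => esym (@munitM l G gset_unit A tt tt tt tt a b))
    (fun a => esym (@munit_star l G gset_unit A tt tt a)) scalar_mx_homog.

Lemma scalar_mx_iso : is_iso (scalar_mx : mor (A : gscat l G) (gmat gset_unit A)).
Proof.
apply: bijective_is_iso => [a /(congr1 (fun f : ffam _ => f (tt, tt)))|b].
  by rewrite [LHS]munitE.
by exists ((b : ffam _) (tt, tt)); apply: ffam_ext => -[[] []]; apply: munitE.
Qed.

Variable Y : gset G.

Definition corner : gsmor A (gmat (gset_sum gset_unit Y) A) :=
  gscomp (mat_incl gset_unit Y A) scalar_mx.

Lemma cornerE a :
  corner a = @munit l G (gset_sum gset_unit Y) A (inl tt) (inl tt) a.
Proof. by apply: ffam_ext => -[[[]|x] [[]|y]]; rewrite [RHS]munitE //; apply: munitE. Qed.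

End One.

(** The corner inclusion of [A] in [M_(1 + Y) A] is an instance of the
    inclusions that a [G]-stable functor inverts, up to the isomorphism of [A]
    with its [1 x 1] matrices. *)
Lemma corner_iso (E : graph) (D : additive_category) (F : functor (gscat l G) D)
    (Y : gset G) (A : gsalg l G) :
  G_stable F E -> card_atmost Y (vert E + edge E + nat + G) ->
  is_iso (fmor F (corner A Y : mor (A : gscat l G) (gmat (gset_sum gset_unit Y) A))).
Proof.
move=> Fst leY.
rewrite -[corner A Y]/(@compm (gscat l G) A _ _ (mat_incl gset_unit Y A) (scalar_mx A)).
rewrite fmorM; apply: is_iso_comp; last exact/functor_iso/scalar_mx_iso.
apply: Fst leY _; first by constructor; exact: tt.
by exists (fun=> inl (inr 0)) => -[] [].
Qed.

End Corner.

(** * Modules over a presented algebra *)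

(** Operators on [V] which satisfy the relations [R] make [V] a module over the
    algebra presented by [R]; this is how an element of that algebra is shown
    to be nonzero. *)
Section PresentedModules.
Variables (l : inv_ring) (X : Type) (V : lmodType l).
Variable act : X -> {linear V -> V}.

Fixpoint tm_act (t : tm l X) (h : V) : V :=
  match t with
  | tgen x => act x h
  | tzero => 0
  | tadd t u => tm_act t h + tm_act u h
  | topp t => - tm_act t h
  | tscale k t => k *: tm_act t h
  | tmul t u => tm_act t (tm_act u h)
  end.

Lemma tm_act_linear t : linear (tm_act t).
Proof.
elim: t => /= [x||t IHt u IHu|t IHt|j t IHt|t IHt u IHu] k h h'.
- exact: linearP.
- by rewrite scaler0 addr0.
- by rewrite IHt IHu scalerDr addrACA.
- by rewrite IHt opprD scalerN.
- by rewrite IHt scalerDr !scalerA mulrC.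
- by rewrite IHu IHt.
Qed.

Variable R : tm l X -> tm l X -> Prop.
Hypothesis R_act : forall t u, R t u -> tm_act t =1 tm_act u.

Lemma tmeq_act t u : tmeq R t u -> tm_act t =1 tm_act u.
Proof.
have actD t' h h' : tm_act t' (h + h') = tm_act t' h + tm_act t' h'.
  by rewrite -{1}(scale1r h) tm_act_linear scale1r.
have act0 t' : tm_act t' 0 = 0.
  by apply: (addIr (tm_act t' 0)); rewrite -actD !add0r.
have actZ t' k h : tm_act t' (k *: h) = k *: tm_act t' h.
  by rewrite -[k *: h]addr0 tm_act_linear act0 addr0.
elim=> {t u} /=.
- exact: R_act.
- by [].
- by move=> t u _ e h; rewrite e.
- by move=> t u v _ e _ e' h; rewrite e e'.
- by move=> t t' u u' _ e _ e' h; rewrite e e'.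
- by move=> t t' _ e h; rewrite e.
- by move=> k t t' _ e h; rewrite e.
- by move=> t t' u u' _ e _ e' h; rewrite e e'.
- by move=> t u v h; rewrite addrA.
- by move=> t u h; rewrite addrC.
- by move=> t h; rewrite add0r.
- by move=> t h; rewrite addNr.
- by move=> j k t h; rewrite scalerA.
- by move=> t h; rewrite scale1r.
- by move=> k t u h; rewrite scalerDr.
- by move=> j k t h; rewrite scalerDl.
- by [].
- by [].
- by move=> t u v h; rewrite actD.
- by [].
- by move=> k t u h; rewrite actZ.
Qed.

Definition pres_act (a : pres R) : V -> V := tm_act (trepr a).

Lemma pres_act_class t : pres_act (tclass R t) =1 tm_act t.
Proof. by apply: tmeq_act; apply: trepr_class. Qed.

Lemma pres_act_gen x h : pres_act (pgen R x) h = act x h.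
Proof. exact: pres_act_class. Qed.

Lemma pres_actM a b h : pres_act (pmul a b) h = pres_act a (pres_act b h).
Proof. exact: pres_act_class. Qed.

Lemma pres_act_linear h : linear (pres_act^~ h).
Proof.
move=> k a b; rewrite -(treprK a) -(treprK b) -tclassZ -tclassD.
by rewrite !pres_act_class.
Qed.

End PresentedModules.

(** * Paths and the Cohn algebra *)

Section Paths.
Variables (l : inv_ring) (G : groupType) (E : graph) (w : edge E -> G).
Local Notation C := (cohn l w).
Local Notation Cv := (@Cv l G E w).
Local Notation Ce := (@Ce l G E w).
Local Notation Cs := (@Cs l G E w).
Local Notation q := (@cohn_q l G E w).
Implicit Types (v : vert E) (e : edge E) (s : seq (edge E)).

(** A path which ends at [v] is given by its list of edges; the vertex is needed
    to make sense of the empty list as the trivial path at [v]. *)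
Definition start v s := if s is e :: _ then src e else v.

Fixpoint ends_at v s :=
  if s is e :: s' then (rng e == start v s') && ends_at v s' else true.

Definition path_weight s : G := foldr (fun e g => w e * g)%g 1%g s.

(** The element [a q_v] for the path [a] with edges [s]. *)
Definition path_q v s : C := foldr (fun e x => gmul (Ce e) x) (q v) s.

Lemma path_q_nil v : path_q v [::] = q v. Proof. by []. Qed.
Lemma path_q_cons v e s : path_q v (e :: s) = gmul (Ce e) (path_q v s).
Proof. by []. Qed.

Lemma gstar_Ce e : gstar (Ce e) = Cs e. Proof. exact: Cgen_star. Qed.

Lemma path_q_homog v s : homog (path_weight s) (path_q v s).
Proof.
elim: s => [|e s IHs]; first exact: cohn_q_homog.
by apply: homogM => //; apply: (Cgen_homog l w (cge e)).
Qed.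

Lemma Cv_path_q u v s :
  gmul (Cv u) (path_q v s) = if u == start v s then path_q v s else 0.
Proof.
case: s => [|e s]; first exact: Cv_q.
by rewrite path_q_cons gmulA CvCe_gen /start; case: eqP => // _; rewrite gmul0l.
Qed.

Lemma Ce_path_q e v s :
  gmul (Ce e) (path_q v s) = if rng e == start v s then path_q v (e :: s) else 0.
Proof.
rewrite -(CeCv l w e) -gmulA Cv_path_q; case: eqP => // _.
exact: gmul0r.
Qed.

Lemma Cs_path_q_cons e v f s : ends_at v (f :: s) ->
  gmul (Cs e) (path_q v (f :: s)) = if e == f then path_q v s else 0.
Proof.
case/andP=> /eqP fs _; rewrite path_q_cons gmulA CsCe.
case: eqP => [->|_]; last exact: gmul0l.
by rewrite Cv_path_q fs eqxx.
Qed.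

Lemma q_Ce v e : is_regular v -> gmul (q v) (Ce e) = 0.
Proof.
move=> rv; apply: (can_inj (@gstarK _ _ _)).
by rewrite gstarM gstar_Ce cohn_q_star Cs_q // gstar0.
Qed.

Lemma path_q_q v s : is_regular v -> gmul (path_q v s) (q v) = path_q v s.
Proof.
move=> rv; elim: s => [|e s IHs]; first by rewrite path_q_nil q_q // eqxx.
by rewrite path_q_cons -gmulA IHs.
Qed.

(** Edges cancel pairwise from [q_u a^* b q_v] by [e^* f = delta_(e,f) r(e)]. When
    they differ the product vanishes; when one path runs out before the other it
    vanishes because [e^* q_v = 0 = q_u f]. *)
Lemma path_q_orth u v s t : is_regular u -> is_regular v ->
  ends_at u s -> ends_at v t ->
  gmul (gstar (path_q u s)) (path_q v t) = if (u == v) && (s == t) then q v else 0.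
Proof.
move=> ru rv; elim: s t => [|e s IHs] [|f t].
- by move=> _ _; rewrite !path_q_nil cohn_q_star q_q // andbT.
- move=> _ _; rewrite path_q_nil path_q_cons cohn_q_star gmulA q_Ce // gmul0l.
  by rewrite andbF.
- move=> _ _; rewrite path_q_nil path_q_cons gstarM gstar_Ce -gmulA Cs_q //.
  by rewrite gmul0r andbF.
move=> /andP[_ es] ft; rewrite path_q_cons gstarM gstar_Ce -gmulA.
rewrite Cs_path_q_cons // eqseq_cons; case: (eqVneq e f) => _.
  by apply: IHs => //; case/andP: ft.
by rewrite gmul0r andbF.
Qed.

Local Notation H := (seq (edge E) * vert E -> l^o).

(** The Cohn algebra acts on functions of pairs of a list of edges and an end
    vertex: [e] prepends itself to a path, [e^*] removes it, and [v] projects to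
    the paths which start at [v]. The relations only concern the first edge and
    the start of a path, so that lists which are not composable may stay. *)
Definition vert_op v (h : H) : H :=
  fun p => if start p.2 p.1 == v then h p else 0.
Definition edge_op e (h : H) : H := fun p =>
  if p.1 is f :: s then
    if (e == f) && (start p.2 s == rng e) then h (s, p.2) else 0
  else 0.
Definition ghost_op e (h : H) : H :=
  fun p => if start p.2 p.1 == rng e then h (e :: p.1, p.2) else 0.

Definition gen_op (x : cohn_gen E) : H -> H :=
  match x with cgv v => vert_op v | cge e => edge_op e | cgs e => ghost_op e end.

Lemma gen_op_linear x : linear (gen_op x).
Proof.
move=> k h h'; apply/funext => -[s v]; case: x => [u|e|e];
  rewrite /= /vert_op /edge_op /ghost_op /=.
- by rewrite -[RHS]/(k *: _ + _) /=; case: ifP; rewrite // scaler0 addr0.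
- rewrite -[RHS]/(k *: _ + _) /=.
  by case: s => [|f s]; [|case: ifP]; rewrite // scaler0 addr0.
- by rewrite -[RHS]/(k *: _ + _) /=; case: ifP; rewrite // scaler0 addr0.
Qed.

HB.instance Definition _ x := GRing.isLinear.Build l H H _ (gen_op x) (gen_op_linear x).

Lemma cohn_rel_op t u : @cohn_rel l E t u ->
  tm_act (fun x => gen_op x : {linear H -> H}) t =1
  tm_act (fun x => gen_op x : {linear H -> H}) u.
Proof.
case=> {t u} [u v|e|e|e|e|e f] h; apply/funext => -[s z];
  rewrite /= ?/vert_op ?/edge_op ?/ghost_op /=.
- have [<-|uv] := eqVneq u v; first by rewrite /= /vert_op /=; case: eqP.
  by rewrite /=; case: eqP => // ->; rewrite (negPf uv).
- case: s => [|f s] /=; first by case: eqP.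
  by case: (eqVneq e f) => [<-|]; rewrite ?eqxx //=; case: ifP.
- by case: s => [|f s] //=; case: eqP => //= _; case: eqP.
- by case: eqP.
- by rewrite eqxx.
- have [<-|ef] := eqVneq e f; first by rewrite /= /vert_op /=; case: eqP.
  by rewrite /=; case: eqP => // _; rewrite eq_sym (negPf ef).
Qed.


Definition vacuum v : H := fun p => if p == ([::], v) then 1 else 0.

Definition vacuum_coeff v (a : C) : l^o :=
  @pres_act l _ H (fun x => gen_op x : {linear H -> H}) (@cohn_rel l E) a
    (vacuum v) ([::], v).

Lemma vacuum_coeff_linear v : linear (vacuum_coeff v).
Proof.
by move=> k a b; rewrite /vacuum_coeff (pres_act_linear cohn_rel_op).
Qed.

HB.instance Definition _ v :=
  GRing.isLinear.Build l C l^o _ (vacuum_coeff v) (vacuum_coeff_linear v).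

(** The vertex [v] fixes the trivial path, while [e e^*] produces paths whose
    first edge is [e]. *)
Lemma vacuum_coeff_q v : vacuum_coeff v (q v) = 1.
Proof.
pose at_nil (h : H) := h ([::], v).
rewrite cohn_qE linearB linear_sum big1 ?subr0 => [|e _].
  rewrite [LHS](congr1 at_nil (pres_act_gen cohn_rel_op (cgv v) _)).
  by rewrite /at_nil /= /vert_op /vacuum /= !eqxx.
rewrite [LHS](congr1 at_nil (pres_actM cohn_rel_op (Ce e) (Cs e) _)).
by rewrite [LHS](congr1 at_nil (pres_act_gen cohn_rel_op (cge e) _)).
Qed.

Lemma cohn_q_free v (c : l) : c *: q v = 0 -> c = 0.
Proof.
move=> cq0; have : c *: vacuum_coeff v (q v) = 0 by rewrite -linearZ cq0 linear0.
by rewrite vacuum_coeff_q => e; rewrite -[LHS]mulr1.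
Qed.

(** * Matrices indexed by paths *)

Definition nontrivial_path v := {s : seq (edge E) | (s != [::]) && ends_at v s}.

Definition nontrivial_paths v : gset G :=
  @GSet G (nontrivial_path v) (fun y => path_weight (val y)).

(** The trivial path is kept as a separate point, for the corner at that path
    to be of the form that stability speaks of. *)
Definition paths_to v : gset G := gset_sum (gset_unit G) (nontrivial_paths v).

Definition path_word v (p : paths_to v) : seq (edge E) :=
  match p with inl _ => [::] | inr y => val y end.

Lemma path_word_ends v (p : paths_to v) : ends_at v (path_word p).
Proof. by case: p => [//|[s /= /andP[]]]. Qed.

Lemma path_word_inj v : injective (@path_word v).
Proof.
move=> [[]|[s s_path]] [[]|[t t_path]] //= e.
- by case/andP: (t_path) => /eqP /(_ (esym e)).
- by case/andP: (s_path) => /eqP /(_ e).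
by congr inr; apply: val_inj.
Qed.

Lemma path_word_onto v s : ends_at v s -> exists p : paths_to v, path_word p = s.
Proof.
case: s => [|e s] s_path; first by exists (inl tt).
have s_in : (e :: s != [::]) && ends_at v (e :: s) by rewrite s_path.
by exists (inr (exist _ (e :: s) s_in)).
Qed.

Lemma path_word_deg v (p : paths_to v) : gdeg p = path_weight (path_word p).
Proof. by case: p. Qed.

Local Notation K := (cohn_K l w).

Lemma reg_regular (v : reg E) : is_regular (val v).
Proof. by have /asboolP := valP v. Qed.

Lemma path_q_in (v : reg E) s : in_ideal (@cohn_qs l G E w) (path_q (val v) s).
Proof.
elim: s => [|e s IHs]; first exact: cohn_q_in.
by rewrite path_q_cons; apply: ideal_mull.
Qed.

(** The element [a q_v b^*] of [K(E)], written [(a q_v) (b q_v)^*]. *)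
Definition path_unit (v : reg E) (p : paths_to (val v) * paths_to (val v)) : K :=
  to_ideal (ideal_mulr (gstar (path_q (val v) (path_word p.2)))
              (path_q_in v (path_word p.1))).

Lemma path_unitE (v : reg E) (x y : paths_to (val v)) :
  ideal_val (path_unit (x, y)) =
  gmul (path_q (val v) (path_word x)) (gstar (path_q (val v) (path_word y))).
Proof. by []. Qed.

Definition scale_by (V : lmodType l) (x : V) (c : l^o) : V := c *: x.

Lemma scale_by_linear (V : lmodType l) (x : V) : linear (scale_by x).
Proof. by move=> k a b; rewrite /scale_by scalerDl -scalerA. Qed.

HB.instance Definition _ (V : lmodType l) (x : V) :=
  GRing.isLinear.Build l l^o V _ (scale_by x) (scale_by_linear x).

Definition path_matrices : gsalg l G :=
  gsum (fun v : reg E => gmat (paths_to (val v)) (gbase l G)).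

Definition matrix_to_K (v : reg E) : {linear gmat (paths_to (val v)) (gbase l G) -> K} :=
  @ffam_lift l _ _ K (fun p => scale_by (path_unit p) : {linear l^o -> K}).

Definition matrices_to_K : {linear path_matrices -> K} :=
  @ffam_lift l (reg E) (fun v : reg E => gmat (paths_to (val v)) (gbase l G)) K
    matrix_to_K.

Definition mxunit (v : reg E) (x y : paths_to (val v)) (c : l) : path_matrices :=
  gsum_in _ v (munit x y (c : gbase l G)).

Lemma matrices_to_K_unit (v : reg E) (x y : paths_to (val v)) (c : l) :
  matrices_to_K (mxunit x y c) = c *: path_unit (x, y).
Proof. by rewrite [LHS]ffam_lift_single [LHS]ffam_lift_single. Qed.

Lemma path_matrices_ind (P : path_matrices -> Prop) :
  P 0 -> (forall a b, P a -> P b -> P (a + b)) ->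
  (forall (v : reg E) (x y : paths_to (val v)) c, P (mxunit x y c)) ->
  forall a, P a.
Proof.
move=> P0 PD P1; apply: ffam_ind => // v; apply: ffam_ind => //.
- by rewrite linear0.
- by move=> f g Pf Pg; rewrite linearD; apply: PD.
- by move=> [x y] c; apply: P1.
Qed.

Lemma mxunitM (v : reg E) (x y x' y' : paths_to (val v)) c d :
  gmul (mxunit x y c) (mxunit x' y' d) = if y == x' then mxunit x y' (c * d) else 0.
Proof.
rewrite -[LHS]gsmorM munitM; case: eqP => // _; exact: linear0.
Qed.

Lemma mxunit_star (v : reg E) (x y : paths_to (val v)) c :
  gstar (mxunit x y c) = mxunit y x (rconj l c).
Proof. by rewrite -[LHS]gsmor_star munit_star. Qed.

Lemma path_unitM (v : reg E) (x y x' y' : paths_to (val v)) :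
  gmul (path_unit (x, y)) (path_unit (x', y')) =
  if y == x' then path_unit (x, y') else 0.
Proof.
apply: ideal_val_inj; have rv := reg_regular v.
rewrite [LHS](congr2 (@gmul _ _ C) (path_unitE x y) (path_unitE x' y')) -gmulA.
rewrite (gmulA (gstar _)) path_q_orth ?path_word_ends // eqxx.
rewrite (inj_eq (@path_word_inj _)) andTb; case: eqP => _; last by rewrite gmul0l gmul0r.
by rewrite gmulA path_q_q.
Qed.

Lemma path_unit_orth (v u : reg E) x y x' y' : v != u ->
  gmul (@path_unit v (x, y)) (@path_unit u (x', y')) = 0.
Proof.
move=> vu; apply: ideal_val_inj; have rv := reg_regular v; have ru := reg_regular u.
rewrite [LHS](congr2 (@gmul _ _ C) (path_unitE x y) (path_unitE x' y')) -gmulA.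
rewrite (gmulA (gstar _)) path_q_orth ?path_word_ends //.
by rewrite (inj_eq val_inj) (negPf vu) andFb gmul0l gmul0r.
Qed.

Lemma path_unit_star (v : reg E) (x y : paths_to (val v)) :
  gstar (path_unit (x, y)) = path_unit (y, x).
Proof.
by apply: ideal_val_inj; rewrite -[LHS]/(gstar (gmul _ (gstar _))) gstarM gstarK.
Qed.

Lemma path_unit_homog (v : reg E) (x y : paths_to (val v)) :
  homog (gdeg x * (gdeg y)^-1)%g (path_unit (x, y)).
Proof.
rewrite !path_word_deg.
exact: (homogM (path_q_homog _ _) (homog_star (path_q_homog _ _))).
Qed.

Lemma matrices_to_K_mul a b :
  matrices_to_K (gmul a b) = gmul (matrices_to_K a) (matrices_to_K b).
Proof.
elim/path_matrices_ind: a => [|a a' IHa IHa'|v x y c].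
- by rewrite gmul0l linear0 gmul0l.
- by rewrite gmulDl !linearD IHa IHa' -gmulDl.
elim/path_matrices_ind: b => [|b b' IHb IHb'|u x' y' d].
- by rewrite gmul0r linear0 gmul0r.
- by rewrite gmulDr !linearD IHb IHb' -gmulDr.
rewrite !matrices_to_K_unit gmulZl gmulZr scalerA.
have [vu|vu] := eqVneq v u; last first.
  by rewrite gsum_in_orth // linear0 path_unit_orth // scaler0.
case: u / vu in x' y' *; rewrite mxunitM path_unitM; case: eqP => _.
  exact: matrices_to_K_unit.
by rewrite linear0 scaler0.
Qed.

Lemma matrices_to_K_star a : matrices_to_K (gstar a) = gstar (matrices_to_K a).
Proof.
elim/path_matrices_ind: a => [|a a' IHa IHa'|v x y c].
- by rewrite gstar0 linear0 gstar0.
- by rewrite gstarD !linearD IHa IHa' -gstarD.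
by rewrite mxunit_star !matrices_to_K_unit gstarZ path_unit_star.
Qed.

(** The entry at [(x, y)] of a matrix of degree [g] lies in the trivially graded
    [l], so it can only be nonzero for [g = |x| |y|^-1]. *)
Lemma matrices_to_K_homog g a : homog g a -> homog g (matrices_to_K a).
Proof.
move=> ga; apply: homog_sum => v; apply: homog_sum => -[x y].
rewrite -[X in homog g X]/((a : ffam _) v (x, y) *: path_unit (x, y)).
have := ga v x y; move: ((a : ffam _) v (x, y)) => c [e|->]; last first.
  by rewrite scale0r; apply: homog0.
apply: homogZ; suff -> : g = (gdeg x * (gdeg y)^-1)%g by apply: path_unit_homog.
apply: (mulgI (gdeg x)^-1%g); apply: (mulIg (gdeg y)).
by rewrite e mulgA mulVg mul1g mulVg.
Qed.

Definition matrices_to_K_mor : gsmor path_matrices K :=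
  GSMor matrices_to_K_mul matrices_to_K_star matrices_to_K_homog.

(** By [path_q_orth], multiplying by [(x q_v)^*] on the left and by [y q_v] on the
    right kills every matrix unit but [epsilon_(x,y)] of the summand of [v]. *)
Lemma matrices_to_K_coeff (a : path_matrices) (v : reg E) (x y : paths_to (val v)) :
  gmul (gstar (path_q (val v) (path_word x)))
    (gmul (ideal_val (matrices_to_K a)) (path_q (val v) (path_word y))) =
  ((a : ffam _) v : ffam _) (x, y) *: q (val v).
Proof.
elim/path_matrices_ind: a => [|a a' IHa IHa'|u x' y' c].
- by rewrite linear0 ideal_val0 gmul0l gmul0r scale0r.
- by rewrite linearD ideal_valD gmulDl gmulDr IHa IHa' -scalerDl.
have rv := reg_regular v; have ru := reg_regular u.
rewrite matrices_to_K_unit ideal_valZ path_unitE gmulZl gmulZr.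
rewrite -gmulA gmulA !path_q_orth ?path_word_ends //.
rewrite !(inj_eq val_inj).
have [uv|uv] := eqVneq u v; last first.
  rewrite !andFb gmul0r scaler0.
  by rewrite [(_ : ffam _) v]single_fun0 ?scale0r //; apply/eqP.
case: v / uv in x y rv *; rewrite !andTb !(inj_eq (@path_word_inj _)).
rewrite [(_ : ffam _) u]single_funE munitE (eq_sym x).
case: (x' == x); case: (y' == y); rewrite ?gmul0l ?gmul0r ?scaler0 ?scale0r //.
by rewrite q_q // eqxx.
Qed.

Lemma matrices_to_K_inj a : matrices_to_K a = 0 -> a = 0.
Proof.
move=> a0; apply: ffam_ext => v; apply: ffam_ext => -[x y].
apply: (@cohn_q_free (val v)).
by rewrite -matrices_to_K_coeff a0 ideal_val0 gmul0l gmul0r.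
Qed.

Definition in_image (a : C) : Prop := exists m, ideal_val (matrices_to_K m) = a.

Lemma in_image0 : in_image 0.
Proof. by exists 0; rewrite linear0. Qed.

Lemma in_imageD a b : in_image a -> in_image b -> in_image (a + b).
Proof. by move=> [m <-] [n <-]; exists (m + n); rewrite linearD. Qed.

Lemma in_imageZ k a : in_image a -> in_image (k *: a).
Proof. by move=> [m <-]; exists (k *: m); rewrite linearZ. Qed.

Lemma in_image_star a : in_image a -> in_image (gstar a).
Proof. by move=> [m <-]; exists (gstar m); rewrite matrices_to_K_star. Qed.

Lemma in_image_path (v : reg E) s t : ends_at (val v) s -> ends_at (val v) t ->
  in_image (gmul (path_q (val v) s) (gstar (path_q (val v) t))).
Proof.
move=> /path_word_onto [x <-] /path_word_onto [y <-].
by exists (mxunit x y 1); rewrite matrices_to_K_unit scale1r.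
Qed.

(** The product of a generator and [a q_v] is zero or some [a' q_v], where [a']
    is [a] itself or [a] with an edge added or removed; it is the regularity of
    [v] that makes [e^* q_v] vanish. *)
Lemma in_image_gen (x : cohn_gen E) a :
  in_image a -> in_image (gmul (pgen (@cohn_rel l E) x : C) a).
Proof.
case=> m <-; elim/path_matrices_ind: m => [|m n IHm IHn|v y z c].
- by rewrite linear0 ideal_val0 gmul0r; apply: in_image0.
- by rewrite linearD ideal_valD gmulDr; apply: in_imageD.
rewrite matrices_to_K_unit ideal_valZ path_unitE gmulZr; apply: in_imageZ.
have := path_word_ends z; have := path_word_ends y; rewrite gmulA.
move: (path_word y) (path_word z) => s t s_path t_path.
have rv := reg_regular v.
case: x => [u|e|e].
- rewrite [gmul _ (path_q _ _)]Cv_path_q; case: ifP => _.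
    exact: in_image_path.
  by rewrite gmul0l; apply: in_image0.
- rewrite [gmul _ (path_q _ _)]Ce_path_q; case: ifP => [es|_].
    by apply: in_image_path => //=; rewrite es.
  by rewrite gmul0l; apply: in_image0.
case: s s_path => [_|f s s_path].
  by rewrite [gmul _ (path_q _ _)]Cs_q // gmul0l; apply: in_image0.
rewrite [gmul _ (path_q _ _)]Cs_path_q_cons //; case: ifP => _.
  by apply: in_image_path => //; case/andP: s_path.
by rewrite gmul0l; apply: in_image0.
Qed.

Lemma in_image_mull (c a : C) : in_image a -> in_image (gmul c a).
Proof.
elim/(@tclass_ind l _ (@cohn_rel l E)): c => t.
elim: t a => [x||t IHt u IHu|t IHt|k t IHt|t IHt u IHu] a im_a.
- exact: in_image_gen.
- by rewrite [X in in_image X]gmul0l; apply: in_image0.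
- by rewrite tclassD gmulDl; apply: in_imageD; [apply: IHt|apply: IHu].
- rewrite tclassN -scaleN1r gmulZl; apply: in_imageZ; exact: IHt.
- by rewrite tclassZ gmulZl; apply: in_imageZ; apply: IHt.
- rewrite tclassM -[X in in_image X]gmulA; apply: IHt; exact: IHu.
Qed.

Lemma in_image_mulr (a c : C) : in_image a -> in_image (gmul a c).
Proof.
move=> im_a; rewrite -[gmul a c]gstarK gstarM.
by apply/in_image_star/in_image_mull/in_image_star.
Qed.

Lemma matrices_to_K_surj (b : K) : exists a, matrices_to_K a = b.
Proof.
suff [a e] : in_image (ideal_val b) by exists a; apply: ideal_val_inj.
elim: (ideal_valP b) => {b} [_ [v rv ->]||a b _ + _|k a _|a b _|a b _].
- have v_reg : `[< is_regular v >] by apply/asboolP.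
  have := @in_image_path (exist _ v v_reg) [::] [::] isT isT.
  by rewrite path_q_nil cohn_q_star q_q // eqxx.
- exact: in_image0.
- exact: in_imageD.
- exact: in_imageZ.
- exact: in_image_mull.
- exact: in_image_mulr.
Qed.

Lemma matrices_to_K_iso : is_iso (matrices_to_K_mor : mor (path_matrices : gscat l G) K).
Proof.
exact: (@bijective_is_iso l G path_matrices K matrices_to_K_mor
  matrices_to_K_inj matrices_to_K_surj).
Qed.

(** A finite graph may have infinitely many paths; the summand [nat] makes the
    bound an infinite alphabet which contains the edges. *)
Lemma nontrivial_paths_card v :
  card_atmost (nontrivial_paths v) (vert E + edge E + nat + G).
Proof.
have [|f f_inj] := @words_card (vert E + edge E + nat + G)%type.
  by exists (fun n => inl (inr n)) => m n [].
exists (fun y => f (map (fun e => inl (inl (inr e))) (val y))).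
by move=> y z /f_inj /inj_map e; apply/val_inj/e => a b [].
Qed.

Lemma q_hom_corner (v : reg E) (c : gbase l G) :
  q_hom l w (gsum_in (fun=> gbase l G) v c) =
  matrices_to_K (gsum_in _ v (corner (gbase l G) (nontrivial_paths (val v)) c)).
Proof.
rewrite cornerE [RHS]matrices_to_K_unit.
rewrite -[LHS]/(q_fun w (gsum_in (fun=> gbase l G) v c)).
rewrite (@q_fun_seq _ _ _ _ _ [:: v]) //; last first.
  by move=> u; rewrite inE => /eqP uv; apply: single_fun0 => vu; apply: uv.
rewrite big_seq1 [(_ : ffam _) v]single_funE; congr (_ *: _).
apply: ideal_val_inj; rewrite -[LHS]/(q (val v)).
rewrite -[RHS]/(gmul (q (val v)) (gstar (q (val v)))).
by rewrite cohn_q_star q_q ?eqxx //; apply: reg_regular.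
Qed.

End Paths.

Theorem proposition11p2 (l : inv_ring) (lam : l) (hlam : lam + rconj l lam = 1)
    (G : groupType) (E : graph) (w : edge E -> G)
    (D : additive_category) (F : functor (gscat l G) D)
    (hadd : is_additive F (reg E)) (hstab : E_stable F E) :
  is_iso (fmor F (q_hom l w)).
Proof.
have [psi [psiK Kpsi]] := matrices_to_K_iso l w.
have psi_iso : is_iso psi by exists (matrices_to_K_mor l w).
(* it remains to invert [psi q], which is a direct sum of corner inclusions *)
apply: (@is_iso_cancell _ _ _ _ (fmor F psi)); first exact: functor_iso.
rewrite -fmorM.
apply: (additive_iso (k := fun v : reg E =>
    corner (gbase l G) (nontrivial_paths w (val v))) hadd) => v.
  by apply: corner_iso; [exact: hstab.2|exact: nontrivial_paths_card].
apply: gsmor_ext => c.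
rewrite -[LHS]/(psi (q_hom l w (gsum_in (fun=> gbase l G) v c))) q_hom_corner.
exact: (congr1 (fun f : gsmor (path_matrices l w) (path_matrices l w) => f _) psiK).
Qed.
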